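(* Let $k,l$ be positive integers and let $\lambda\vdash k$, $\mu\vdash l$ and $\nu\vdash kl$. Then, for all $a\gg 0$, the value $\mathbf{b}^{\nu^{(la)}}_{\lambda^{(a)},\mu}$ is constant; that is, there is $a_0$ such that $\mathbf{b}^{\nu^{(la)}}_{\lambda^{(a)},\mu}=\mathbf{b}^{\nu^{(la_0)}}_{\lambda^{(a_0)},\mu}$ for all integers $a\geq a_0$.
   Context: $\Bbbk$ is an algebraically closed field of characteristic zero; $\mathbf{S}^\lambda$ denotes the Specht module over $\Bbbk$ of a symmetric group. For positive integers $k,l$, the group $S_k\times S_l$ is embedded in $S_{kl}$ by identifying the $kl$ points with the entries of a $k\times l$ matrix (read left-to-right and then top-to-bottom) and letting $S_k$ permute the rows and $S_l$ permute the columns. For $\lambda\vdash k$, $\mu\vdash l$ and $\nu\vdash kl$, $\mathbf{b}^\nu_{\lambda,\mu}$ denotes the multiplicity of $\mathbf{S}^\lambda\otimes_\Bbbk\mathbf{S}^\mu$ in the restriction of $\mathbf{S}^\nu$ from $S_{kl}$ to $S_k\times S_l$. For a partition $\lambda=(\lambda_1,\lambda_2,\dots)\vdash n$ and a positive integer $a$, $\lambda^{(a)}:=(\lambda_1+a,\lambda_2,\lambda_3,\dots)\vdash n+a$. (Thus $\lambda^{(a)}\vdash k+a$ and $\nu^{(la)}\vdash (k+a)l$.) *)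

(* Defs.v *)
From HB Require Import structures.
From mathcomp Require Import all_boot all_order all_algebra.
From mathcomp Require Import all_fingroup all_solvable all_field all_character.
From mathcomp Require Import boolp.
Set Implicit Arguments.
Unset Strict Implicit.
Unset Printing Implicit Defensive.
Import GRing.Theory.
Local Open Scope ring_scope.

Definition is_partition (n : nat) (la : seq nat) : bool :=
  [&& sorted geq la, 0%N \notin la & sumn la == n].

Definition add_first_row (a : nat) (la : seq nat) : seq nat :=
  (head 0 la + a)%N :: behead la.

Section PermRepr.
Variables (F : fieldType) (aT : finGroupType) (T : finType).
Variable to : {action aT &-> T}.

Definition perm_repr_fun (x : aT) : 'M[F]_#|T| :=
  \matrix_(i, j) (to (enum_val i) x == enum_val j)%:R.

Lemma delta_perm_repr (u : T) x :
  delta_mx 0 (enum_rank u) *m perm_repr_fun x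
    = delta_mx 0 (enum_rank (to u x)) :> 'rV_#|T|.
Proof.
rewrite -rowE; apply/rowP=> j; rewrite !mxE enum_rankK eqxx /=.
by rewrite -(inj_eq enum_val_inj) enum_rankK eq_sym.
Qed.

Lemma perm_repr_subproof : mx_repr [set: aT] perm_repr_fun.
Proof.
split=> [|x y _ _]; apply/row_matrixP=> i; rewrite -(enum_valK i).
  by rewrite row1 rowE delta_perm_repr act1.
by rewrite row_mul !rowE !delta_perm_repr actMin ?inE.
Qed.

(* Vectors are rows and x : aT acts on them on the right, sending the basis   *)
(* vector of u : T to that of to u x.                                         *)
Definition perm_repr := MxRepresentation perm_repr_subproof.
End PermRepr.

(* Cells of the diagram of la are numbered row by row by the positions        *)
(* p : 'I_n (n = sumn la); cell p is in row reshape_index la p and column     *)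
(* reshape_offset la p.  A tableau t : 'S_n puts the entry t p in cell p, and *)
(* as (s * t) p = t (s p), x acts on entries by t |-> t * x, and a            *)
(* permutation s of the cells acts by t |-> s * t.                            *)
Section Specht.
Variables (F : fieldType) (n : nat) (la : seq nat).

Definition row_stab : {set 'S_n} :=
  [set s : 'S_n | [forall p : 'I_n, reshape_index la (s p) == reshape_index la p]].

Definition col_stab : {set 'S_n} :=
  [set s : 'S_n | [forall p : 'I_n, reshape_offset la (s p) == reshape_offset la p]].

(* The class of t under row equivalence. *)
Definition tabloid (t : 'S_n) : {set 'S_n} := (row_stab :* t)%g.

(* Tabloid vectors live in the permutation module on all sets of tableaux,    *)
(* where they span the usual permutation module M^la.                         *)
Definition tabloid_vec (t : 'S_n) : 'rV[F]_#|{set 'S_n}| :=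
  delta_mx 0 (enum_rank (tabloid t)).

(* The column stabilizer of t consists of the s ^ t with s \in col_stab, and  *)
(* acting on the entries of t by s ^ t yields t * s ^ t = s * t.              *)
Definition polytabloid (t : 'S_n) : 'rV[F]_#|{set 'S_n}| :=
  \sum_(s in col_stab) (-1) ^+ odd_perm s *: tabloid_vec (s * t)%g.

Definition specht_mx : 'M[F]_#|{set 'S_n}| :=
  (\sum_(t : 'S_n) <<polytabloid t>>)%MS.

Definition tableau_set_repr := perm_repr F ('Rs : {action 'S_n &-> {set 'S_n}}).

Lemma polytabloid_act t x :
  polytabloid t *m tableau_set_repr x = polytabloid (t * x)%g.
Proof.
rewrite /polytabloid mulmx_suml; apply: eq_bigr => s _.
by rewrite -scalemxAl delta_perm_repr /tabloid /= rcosetE -rcosetM mulgA.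
Qed.

Lemma specht_module : mxmodule tableau_set_repr specht_mx.
Proof.
apply/mxmoduleP=> x _; rewrite sumsmxMr; apply/sumsmx_subP=> t _.
rewrite (eqmxMr _ (genmxE _)) polytabloid_act.
by rewrite (sumsmx_sup (t * x)%g) // genmxE.
Qed.

Definition specht_repr := submod_repr specht_module.
End Specht.

Section Multiplicity.
Variables (F : closedFieldType) (gT : finGroupType) (G : {group gT}).
Variables (n m : nat) (rS : mx_representation F G n).
Variable rG : mx_representation F G m.

(* For irreducible rS, at most one component W contributes. *)
Definition repr_mult : nat :=
  \sum_(W : DecSocleType rG | `[< mx_rsim rS (socle_repr W) >]) socle_mult W.
End Multiplicity.

Section Pullback.
Variables (F : fieldType) (aT rT : finGroupType).
Variables (f : {morphism [set: aT] >-> rT}) (n : nat).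
Variable rG : mx_representation F [set: rT] n.

Lemma pullback_sub : [set: aT] \subset (f @*^-1 [set: rT])%g.
Proof. by apply/subsetP=> x _; rewrite !inE. Qed.

Definition pullback_repr : mx_representation F [set: aT] n :=
  subg_repr (morphpre_repr f rG) pullback_sub.
End Pullback.

(* mxvec_index i j is the position i * l + j of the entry (i, j). *)
Section MatrixEmbedding.
Variables k l : nat.

Definition cell_of (p : 'I_(k * l)) : 'I_k * 'I_l :=
  enum_val (cast_ord (esym (mxvec_cast k l)) p).

Lemma mxvec_indexK i j : cell_of (mxvec_index i j) = (i, j).
Proof. by rewrite /cell_of /mxvec_index cast_ordK enum_rankK. Qed.

Definition embed_fun (st : 'S_k * 'S_l) (p : 'I_(k * l)) : 'I_(k * l) :=
  mxvec_index (st.1 (cell_of p).1) (st.2 (cell_of p).2).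

Lemma embed_inj st : injective (embed_fun st).
Proof.
move=> p q; case/mxvec_indexP: p => i j; case/mxvec_indexP: q => i' j'.
rewrite /embed_fun !mxvec_indexK /= => /(congr1 cell_of).
by rewrite !mxvec_indexK => -[/perm_inj-> /perm_inj->].
Qed.

Definition embed (st : 'S_k * 'S_l) : 'S_(k * l) := perm (@embed_inj st).

Lemma embedM : {in [set: 'S_k * 'S_l] &, {morph embed : x y / (x * y)%g}}.
Proof.
move=> x y _ _; apply/permP=> p; rewrite permM !permE.
by rewrite /embed_fun mxvec_indexK /= !permM.
Qed.

Canonical embed_morphism := Morphism embedM.
End MatrixEmbedding.

Section BCoefficient.
Variables (F : closedFieldType) (k l : nat) (la mu nu : seq nat).

(* External tensor product, for la |- k and mu |- l. *)
Definition specht_tensor :=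
  prod_repr (pullback_repr (fst_morphism 'S_k 'S_l) (specht_repr F k la))
            (pullback_repr (snd_morphism 'S_k 'S_l) (specht_repr F l mu)).

(* Restriction to 'S_k x 'S_l, for nu |- k * l. *)
Definition specht_restr :=
  pullback_repr (embed_morphism k l) (specht_repr F (k * l) nu).

Definition b_coef : nat := repr_mult specht_tensor specht_restr.
End BCoefficient.

(* Main.v *)
Require Import Defs.
From mathcomp Require Import all_boot all_order all_algebra.
From mathcomp Require Import all_fingroup all_solvable all_character.
From mathcomp Require Import boolp ring zify.

(** The multiplicity is the dimension of a space of highest weight vectors in a
    symmetric power, and for large [a] multiplication by a single letter [x0]
    identifies the spaces belonging to [a] and to [a + 1].

    Specht modules as highest weight vectors.  A tabloid of shape [eta] with [N]
    entries is a word of length [N]: the letter at position [x] is the row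
    containing the entry [x].  Functions on such words form a tensor power, on
    which the raising operators [raise setT i j] with [i < j] act.  The span of the
    polytabloids is exactly the space of functions of weight [eta] killed by all
    these operators ([highest]).  Polytabloids are killed because the terms cancel
    in pairs ([raise_poly_word]).  Conversely, by the representation theory of sl2
    ([highest_weight_leq]) the leading word of a highest weight vector is a lattice
    word ([leading_lattice]), hence the leading word of the polytabloid of a standard
    tableau ([leading_tableau]), which can be subtracted ([highest_span]).

    Multiplicities as dimensions.  An operator commuting with the symmetric group
    sends a polytabloid to a multiple of itself ([equivariant_poly_word]), since the
    signed sum over the column stabiliser of a tableau has rank one.  So the Gram
    matrix of all polytabloids is, up to a nonzero scalar, a symmetric idempotent
    with the Specht module as its image.  It follows that Specht modules have
    characters of norm one, invariant under [g |-> g^-1].  By orthogonality of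
    characters, the multiplicity is then the dimension of the space of invariants of
    'S_n x 'S_l in the tensor product of the three Specht modules: the functions
    [T (x1, x2, x3)] of three words, invariant under the group and of highest weight
    in each argument ([b_coef_dim]).

    Stability.  The word [x1] labels the [n] rows of the matrix and the word [x3]
    fills it, so [(x1, x3)] is a word of length [n] in labelled rows, and invariance
    under 'S_n makes [T] an element of the [n]-th symmetric power of the space with
    the labelled rows as basis.  The raising operators in [x1] and [x3] become
    derivations of the symmetric algebra that kill the row [x0] filled with 0 and
    labelled 0, the highest weight vector among the letters.  Hence multiplication by
    [x0] commutes with them; it is injective, and turns the weights for [a] into those
    for [a + 1].  Once [a >= k * l] every word of the right weight contains [x0], so
    every element is a multiple of [x0], and the quotient is again killed by the
    derivations because multiplication by [x0] is injective ([stable_dim]). *)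

Set Implicit Arguments.
Unset Strict Implicit.
Unset Printing Implicit Defensive.
Import Order.TTheory GRing.Theory Num.Theory.
Local Open Scope ring_scope.

(** * Characters and multiplicities *)

Section CharacterPairing.
Variables (F : fieldType) (gT : finGroupType) (G : {group gT}).
Hypothesis charF0 : [pchar F] =i pred0.

Lemma natr_char0_neq0 n : (n%:R != 0 :> F) = (n != 0)%N.
Proof. by rewrite ((pcharf0P F).1 charF0). Qed.

Lemma natr_char0_inj : injective (fun n => n%:R : F).
Proof.
move=> m n /=; wlog le_mn: m n / (m <= n)%N => [hw|].
  by case/orP: (leq_total m n) => le eq_mn; [|symmetry]; apply: hw.
move/eqP; rewrite eq_sym -subr_eq0 -natrB // ((pcharf0P F).1 charF0) subn_eq0 => le.
by apply/eqP; rewrite eqn_leq le_mn.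
Qed.

Lemma card_group_neq0 : #|G|%:R != 0 :> F.
Proof. by rewrite natr_char0_neq0 -lt0n cardG_gt0. Qed.

Definition pairing (chi psi : gT -> F) : F :=
  #|G|%:R^-1 * \sum_(g in G) chi g^-1%g * psi g.

(** A representation over a general field has no class function in 'CF(G),
    whose values are algebraic numbers; its character is a plain function. *)
Definition repr_tr n (rG : mx_representation F G n) (g : gT) : F := \tr (rG g).

Lemma eq_pairing chi chi' psi psi' :
    {in G, chi =1 chi'} -> {in G, psi =1 psi'} ->
  pairing chi psi = pairing chi' psi'.
Proof.
move=> eq1 eq2; congr (_ * _); apply: eq_bigr => g Gg.
by rewrite eq1 ?groupV // eq2.
Qed.

Lemma pairing_suml (I : finType) (c : I -> nat) (chi : I -> gT -> F) psi :
  pairing (fun g => \sum_i chi i g *+ c i) psi = \sum_i pairing (chi i) psi *+ c i.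
Proof.
rewrite /pairing; under eq_bigr do rewrite mulr_suml.
rewrite exchange_big mulr_sumr; apply: eq_bigr => i _.
rewrite -mulrnAr -sumrMnl; congr (_ * _).
by apply: eq_bigr => g _; rewrite mulrnAl.
Qed.

Lemma pairing_sumr (I : finType) (c : I -> nat) (psi : I -> gT -> F) chi :
  pairing chi (fun g => \sum_i psi i g *+ c i) = \sum_i pairing chi (psi i) *+ c i.
Proof.
rewrite /pairing; under eq_bigr do rewrite mulr_sumr.
rewrite exchange_big mulr_sumr; apply: eq_bigr => i _.
rewrite -mulrnAr -sumrMnl; congr (_ * _).
by apply: eq_bigr => g _; rewrite mulrnAr.
Qed.

(** Averaging an arbitrary matrix [B] over the group gives an intertwiner
    ([average_hom]), to which Schur's lemma applies. *)
Definition average n m (rS : mx_representation F G n)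
    (rG : mx_representation F G m) (B : 'M[F]_(n, m)) :=
  \sum_(g in G) rS g^-1%g *m B *m rG g.

Lemma average_hom n m (rS : mx_representation F G n)
    (rG : mx_representation F G m) B x :
  x \in G -> rS x *m average rS rG B = average rS rG B *m rG x.
Proof.
move=> Gx; rewrite /average mulmx_sumr mulmx_suml.
rewrite [LHS](reindex_acts 'R _ Gx) ?astabsR //=.
apply: eq_bigr => g Gg; rewrite !mulmxA -repr_mxM ?groupV ?groupM //.
by rewrite invMg mulKVg -!mulmxA -repr_mxM.
Qed.

(** The pairing of two characters is a sum of entries of averages of elementary
    matrices, which is how Schur's lemma enters. *)
Lemma sum_average n m (rS : mx_representation F G n)
    (rG : mx_representation F G m) :
  \sum_i \sum_j average rS rG (delta_mx i j) i j
    = \sum_(g in G) repr_tr rS g^-1%g * repr_tr rG g.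
Proof.
rewrite /average /repr_tr /mxtrace.
transitivity (\sum_i \sum_j \sum_(g in G) rS g^-1%g i i * rG g j j).
  apply: eq_bigr => i _; apply: eq_bigr => j _; rewrite summxE.
  apply: eq_bigr => g _; rewrite mxE (bigD1 j) //= big1 => [|k ne_kj].
    rewrite addr0 mxE (bigD1 i) //= big1 => [|k ne_ki].
      by rewrite addr0 mxE !eqxx mulr1.
    by rewrite mxE (negPf ne_ki) mulr0.
  rewrite mxE big1 ?mul0r // => k' _.
  by rewrite mxE (negPf ne_kj) andbF mulr0.
under eq_bigr do rewrite exchange_big; rewrite exchange_big /=.
apply: eq_bigr => g _; rewrite mulr_suml; apply: eq_bigr => i _.
by rewrite mulr_sumr.
Qed.

Lemma rsim_of_hom n m (rS : mx_representation F G n)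
    (rG : mx_representation F G m) (B : 'M_(n, m)) :
    mx_irreducible rS -> mx_irreducible rG ->
    (forall x, x \in G -> rS x *m B = B *m rG x) -> B != 0 -> mx_rsim rS rG.
Proof.
move=> /mx_irrP[n_gt0 irrS] /mx_irrP[m_gt0 irrG] homB nzB.
have fullB: row_full B.
  have modB: mxmodule rG <<B>>%MS.
    apply/mxmoduleP=> x Gx; rewrite (eqmxMr _ (genmxE _)) genmxE.
    by rewrite -homB // submxMl.
  have nzgB: <<B>>%MS != 0 by rewrite -mxrank_eq0 genmxE mxrank_eq0.
  by have := irrG _ modB nzgB; rewrite /row_full genmxE.
have freeB: row_free B.
  rewrite -kermx_eq0; apply: contraT => nzK.
  have modK: mxmodule rS (kermx B).
    apply/mxmoduleP=> x Gx; apply/sub_kermxP.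
    by rewrite -mulmxA homB // mulmxA mulmx_ker mul0mx.
  have := irrS _ modK nzK; rewrite -sub1mx => /sub_kermxP.
  by rewrite mul1mx => B0; rewrite B0 eqxx in nzB.
exists B => //; move: fullB freeB.
by rewrite /row_full /row_free => /eqP rkm /eqP rkn; rewrite -rkm.
Qed.


End CharacterPairing.

Section ClosedPairing.
Variables (F : closedFieldType) (gT : finGroupType) (G : {group gT}).
Hypothesis charF0 : [pchar F] =i pred0.

(** Orthogonality of irreducible characters: by Schur's lemma the averages are
    0 or scalar matrices, and the trace determines the scalar. *)
Lemma pairing_irr n m (rS : mx_representation F G n)
    (rG : mx_representation F G m) :
    mx_irreducible rS -> mx_irreducible rG ->
  pairing G (repr_tr rS) (repr_tr rG) = (`[< mx_rsim rS rG >])%:R.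
Proof.
move=> irrS irrG; case: asboolP => [simSG | nsimSG]; last first.
  rewrite /pairing -sum_average big1 ?mulr0 // => i _; rewrite big1 // => j _.
  apply/eqP; apply: contraT => nzB; case: nsimSG.
  apply: (rsim_of_hom irrS irrG (average_hom rS rG (delta_mx i j))).
  by apply: contraNneq nzB => ->; rewrite mxE.
rewrite (@eq_pairing _ _ _ _ (repr_tr rS) _ (repr_tr rS)) //; last first.
  by move=> g Gg; rewrite /repr_tr (mxtrace_rsim simSG).
rewrite /pairing -sum_average.
have [n_gt0 _] := (mx_irrP rS).1 irrS.
have nzn: n%:R != 0 :> F by rewrite natr_char0_neq0 // -lt0n.
have absS := group_closure_closed_field irrS.
have avgE i j : average rS rS (delta_mx i j) = ((i == j)%:R * #|G|%:R / n%:R)%:M.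
  have /is_scalar_mxP[c def_c]: is_scalar_mx (average rS rS (delta_mx i j)).
    apply: (mx_abs_irr_cent_scalar absS); apply/centgmxP=> x Gx.
    by rewrite average_hom.
  rewrite def_c; congr (_%:M); apply: (mulIf nzn); rewrite divfK //.
  have := congr1 mxtrace def_c; rewrite mxtrace_scalar -[c *+ n]mulr_natr => <-.
  rewrite /average linear_sum /=.
  rewrite (eq_bigr (fun=> (i == j)%:R)) ?sumr_const ?mulr_natr // => g Gg.
  rewrite mxtrace_mulC mulmxA -repr_mxM ?groupV // mulgV repr_mx1 mul1mx.
  rewrite /mxtrace (bigD1 i) //= mxE eqxx big1 ?addr0 // => k ne_ki.
  by rewrite mxE (negPf ne_ki).
rewrite (eq_bigr (fun=> #|G|%:R / n%:R)) => [|i _].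
  rewrite sumr_const card_ord -[_ / _ *+ n]mulr_natr divfK // mulVf //.
  exact: card_group_neq0.
rewrite (bigD1 i) //= big1 => [|j ne_ji].
  by rewrite avgE !mxE !eqxx mulr1n mul1r addr0.
by rewrite avgE eq_sym (negPf ne_ji) !mul0r mxE mul0rn.
Qed.

Section Decomposition.
Variables (m : nat) (rG : mx_representation F G m).
Let sG := DecSocleType rG.

Lemma Maschke_char0 : mx_completely_reducible rG 1%:M.
Proof.
apply: mx_Maschke_pchar; rewrite /pgroup pcharf'_nat.
exact: card_group_neq0.
Qed.

Lemma repr_tr_Socle :
  {in G, repr_tr rG =1
     fun g => \sum_(W : sG) repr_tr (socle_repr W) g *+ socle_mult W}.
Proof.
move=> g Gg; rewrite /repr_tr -mxtrace_Socle // mxtrace_submod1 //.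
by rewrite reducible_Socle1 //; apply: Maschke_char0.
Qed.

(** Both sides are additive in the Socle decomposition, which is the whole space by
    Maschke's theorem. *)
Lemma repr_mult_pairing n (rS : mx_representation F G n) :
    mx_irreducible rS ->
  (repr_mult rS rG)%:R = pairing G (repr_tr rS) (repr_tr rG).
Proof.
move=> irrS; rewrite (eq_pairing (fun _ _ => erefl) repr_tr_Socle).
rewrite pairing_sumr /repr_mult big_mkcond natr_sum; apply: eq_bigr => W _.
rewrite pairing_irr //; last exact: socle_irr.
by case: asboolP => _; rewrite ?mul0rn.
Qed.

Lemma socle_mult_gt0 (W : sG) : (0 < socle_mult W)%N.
Proof.
have simW := socle_simple W; rewrite divn_gt0; last first.
  by rewrite lt0n mxrank_eq0; case: simW.
exact: mxrankS (component_mx_id simW).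
Qed.

(** A character of norm one is irreducible: its norm is the sum of the squares
    of the multiplicities. *)
Lemma irreducible_of_pairing1 :
  pairing G (repr_tr rG) (repr_tr rG) = 1 -> mx_irreducible rG.
Proof.
rewrite (eq_pairing repr_tr_Socle repr_tr_Socle) pairing_suml.
under eq_bigr do rewrite pairing_sumr.
have pairW (W W' : sG) : pairing G (repr_tr (socle_repr W))
    (repr_tr (socle_repr W')) = (W == W')%:R.
  rewrite pairing_irr; try exact: socle_irr; congr (nat_of_bool _)%:R.
  by apply/asboolP/socle_rsimP.
under eq_bigr => W _ do (under eq_bigr do rewrite pairW;
  rewrite (bigD1 W) //= eqxx big1 ?addr0;
  last by move=> W' /negPf ne; rewrite eq_sym ne mul0rn).
under eq_bigr do rewrite -mulrnA.
(* An equality between natural numbers, as the field has characteristic 0. *)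
rewrite -natr_sum => /(natr_char0_inj charF0 (x2 := 1)) sum1.
have [W _ | W0] := pickP (fun _ : sG => true); last first.
  by rewrite big_pred0 in sum1.
move: sum1; rewrite (bigD1 W) //=.
have mW := socle_mult_gt0 W.
case eqW: (socle_mult W) mW => [|[|k]] // _.
rewrite mul1n => /eqP; rewrite -[X in _ == X]addn0 eqn_add2l => /eqP sum0.
have uniqW W' : W' = W.
  apply/eqP; apply: contraT => neW'; move: sum0; rewrite (bigD1 W') //=.
  by have := socle_mult_gt0 W'; case: socle_mult.
(* The trace at 1 compares degrees: the only constituent fills the space. *)
have trE := repr_tr_Socle (group1 G).
rewrite (bigD1 W) //= big1 ?addr0 in trE; last first.
  by move=> W'; rewrite (uniqW W') eqxx.
rewrite /repr_tr !repr_mx1 !mxtrace1 eqW in trE.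
have rkW := natr_char0_inj charF0 trE.
have [modW _ _] := socle_simple W.
have fullW : (socle_base W :=: 1%:M)%MS.
  by apply/eqmxP; rewrite submx1 sub1mx /row_full -rkW eqxx.
have sim := rsim_submod1 (socle_module W) fullW.
exact: mx_rsim_irr sim (socle_irr W).
Qed.

End Decomposition.
End ClosedPairing.

(** * Dimensions as traces of idempotents *)

Section Dimension.
Variable F : fieldType.

Definition fun_linear (U : lmodType F) (Y : Type) (f : U -> Y -> F) :=
  forall a u v y, f (a *: u + v) y = a * f u y + f v y.

(** Presenting a space of functions by a linear bijection from row vectors lets
    dimensions be compared across different domains [X] by composition. *)
Definition has_dim (X : Type) (P : (X -> F) -> Prop) (d : nat) :=
  exists f : 'rV[F]_d -> X -> F,
    [/\ fun_linear f, forall u, (forall x, f u x = 0) -> u = 0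
      & forall v, P v <-> exists u, v =1 f u].

Lemma fun_linear0 (U : lmodType F) (Y : Type) (f : U -> Y -> F) y :
  fun_linear f -> f 0 y = 0.
Proof.
move=> lin_f; have := lin_f (-1) 0 0 y.
by rewrite scaler0 addr0 mulN1r addNr.
Qed.

Lemma fun_linear_sum (U : lmodType F) (Y I : Type) (f : U -> Y -> F) r
    (c : I -> F) (u : I -> U) y :
  fun_linear f ->
  f (\sum_(i <- r) c i *: u i) y = \sum_(i <- r) c i * f (u i) y.
Proof.
move=> lin_f; elim: r => [|i r IH]; last by rewrite !big_cons lin_f IH.
by rewrite !big_nil fun_linear0.
Qed.

Lemma has_dim_leq (X : Type) (P : (X -> F) -> Prop) d e :
  has_dim P d -> has_dim P e -> (d <= e)%N.
Proof.
move=> [f [lin_f inj_f rng_f]] [g [lin_g inj_g rng_g]].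
have /choice[a aE] (i : 'I_d) : exists u, f (delta_mx 0 i) =1 g u.
  by apply/rng_g/rng_f; exists (delta_mx 0 i).
pose A : 'M_(d, e) := \matrix_i a i.
have fA u x : f u x = g (u *m A) x.
  rewrite {1}[u]row_sum_delta fun_linear_sum // mulmx_sum_row fun_linear_sum //.
  by apply: eq_bigr => i _; rewrite rowK aE.
suff freeA: row_free A by rewrite -(eqP freeA) rank_leq_col.
rewrite -kermx_eq0; apply/eqP/row_matrixP=> i; rewrite row0.
by apply: inj_f => x; rewrite fA -row_mul mulmx_ker row0 fun_linear0.
Qed.

Lemma has_dim_uniq (X : Type) (P : (X -> F) -> Prop) d e :
  has_dim P d -> has_dim P e -> d = e.
Proof. by move=> dimd dime; apply/eqP; rewrite eqn_leq !(has_dim_leq _ _ (P := P)). Qed.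

Lemma has_dim_iso (X Y : Type) (P : (X -> F) -> Prop) (Q : (Y -> F) -> Prop)
    (phi : (X -> F) -> Y -> F) d :
    (forall a u v y, phi (fun x => a * u x + v x) y = a * phi u y + phi v y) ->
    (forall u, P u -> Q (phi u)) ->
    (forall u, P u -> (forall y, phi u y = 0) -> forall x, u x = 0) ->
    (forall v, Q v -> exists2 u, P u & v =1 phi u) ->
  has_dim P d -> has_dim Q d.
Proof.
move=> lin_phi PQ inj_phi surj_phi [f [lin_f inj_f rng_f]].
have Pf u : P (f u) by apply/rng_f; exists u.
exists (fun u => phi (f u)); split=> [a u v y|u phi0|v].
- by rewrite -lin_phi; congr (phi _ y); apply/funext=> x; apply: lin_f.
- by apply: inj_f => x; apply: inj_phi phi0 x; apply: Pf.
split=> [/surj_phi[u /rng_f[c uE] vE]|[c vE]].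
  by exists c => y; rewrite vE (funext uE).
by rewrite (funext vE); apply/PQ/Pf.
Qed.

(** The base change of [M = C *m R] to full rank factors gives [R *m C = 1] when [M]
    is idempotent, so that its trace is its rank; this is how a dimension becomes a
    sum of character values. *)
Lemma has_dim_idempotent (X : finType) (A : X -> X -> F) :
    (forall x z, \sum_y A x y * A y z = A x z) ->
  exists2 d, has_dim (fun v => forall y, \sum_x v x * A x y = v y) d
           & d%:R = \sum_x A x x.
Proof.
move=> idemA; pose M : 'M_#|X| := \matrix_(i, j) A (enum_val i) (enum_val j).
have sum_enum (f : X -> F) : \sum_x f x = \sum_(i < #|X|) f (enum_val i).
  by rewrite (reindex_onto (@enum_val X _) enum_rank) => [|x _]; rewrite ?enum_rankK //;
  apply: eq_bigl => i; rewrite enum_valK eqxx.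
have idemM : M *m M = M.
  apply/matrixP=> i j; rewrite !mxE -idemA sum_enum.
  by apply: eq_bigr => k _; rewrite !mxE.
have RC : row_base M *m col_base M = 1%:M.
  apply: (row_free_inj (row_base_free M)).
  have [C' C'C] := row_fullP (col_base_full M).
  have CRC : col_base M *m (row_base M *m col_base M *m row_base M)
      = col_base M *m row_base M by rewrite -mulmxA mulmx_base mulmxA mulmx_base.
  have := congr1 (mulmx C') CRC.
  by rewrite 2!(mulmxA C') C'C !mul1mx.
exists (\rank M); last first.
  transitivity (\tr M); last by rewrite /mxtrace sum_enum; apply: eq_bigr => i _; rewrite mxE.
  by rewrite -{2}(mulmx_base M) mxtrace_mulC RC mxtrace1.
exists (fun u x => (u *m row_base M) 0 (enum_rank x)); split=> [a u v x|u u0|v].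
- by rewrite mulmxDl -scalemxAl !mxE.
- apply: (row_free_inj (row_base_free M)); rewrite mul0mx; apply/rowP=> i.
  by rewrite -(enum_valK i) u0 mxE.
(* [C] and [R] provide the two directions of the bijection with the fixed space. *)
pose w : 'rV_#|X| := \row_i v (enum_val i).
have wM y : (w *m M) 0 (enum_rank y) = \sum_x v x * A x y.
  by rewrite mxE sum_enum; apply: eq_bigr => i _; rewrite !mxE enum_rankK.
split=> [fixv | [u vE] y].
  exists (w *m col_base M) => x.
  by rewrite -mulmxA mulmx_base wM fixv.
rewrite -wM; suff ->: w = u *m row_base M.
  have RM : row_base M *m M = row_base M.
    by rewrite -[X in _ *m X = _]mulmx_base mulmxA RC mul1mx.
  by rewrite -mulmxA RM vE.
by apply/rowP=> i; rewrite mxE vE enum_valK.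
Qed.

End Dimension.

Section InvariantDimension.
Variables (F : fieldType) (gT : finGroupType) (X : finType).
Hypothesis charF0 : [pchar F] =i pred0.
Variables (act : X -> gT -> X) (K : X -> X -> F).
Hypothesis act1 : forall x, act x 1%g = x.
Hypothesis actM : forall x g h, act x (g * h)%g = act (act x g) h.
Hypothesis K_act : forall g x y, K (act x g) (act y g) = K x y.
Hypothesis K_idem : forall x z, \sum_y K x y * K y z = K x z.

Lemma act_inj g : injective (fun x => act x g).
Proof. by move=> x y /(congr1 (act^~ g^-1%g)); rewrite -!actM mulgV !act1. Qed.

Lemma sum_act (f : X -> F) g : \sum_x f x = \sum_x f (act x g).
Proof. by rewrite (reindex_inj (@act_inj g)). Qed.

(** The invariants in the image of an equivariant idempotent [K] are the image
    of the idempotent obtained by averaging [K] over the group. *)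
Lemma has_dim_invariants :
  exists2 d, has_dim (fun v => (forall g x, v (act x g) = v x)
                               /\ (forall y, \sum_x v x * K x y = v y)) d
           & d%:R = #|[set: gT]|%:R^-1 * \sum_g \sum_x K (act x g) x.
Proof.
set nG := #|[set: gT]|%:R; have nzG : nG != 0 :> F by apply: card_group_neq0.
pose A x y : F := nG^-1 * \sum_g K (act x g) y.
pose fixA v := forall y, \sum_x v x * A x y = v y.
have appE v y : \sum_x v x * A x y = nG^-1 * \sum_g \sum_x v x * K (act x g) y.
  rewrite exchange_big mulr_sumr; apply: eq_bigr => x _.
  by rewrite -mulr_sumr mulrCA.
have A_act g x y : A x (act y g) = A x y.
  congr (_ * _); rewrite (reindex_inj (mulIg g)) /=.
  by apply: eq_bigr => h _; rewrite actM K_act.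
have A_K x z : \sum_y A x y * K y z = A x z.
  under eq_bigr do rewrite -mulrA mulr_suml.
  rewrite -mulr_sumr exchange_big; congr (_ * _).
  by apply: eq_bigr => g _; rewrite K_idem.
have fixAP v : fixA v <-> (forall g x, v (act x g) = v x)
                          /\ (forall y, \sum_x v x * K x y = v y).
  split=> [fixv | [inv_v vK] y].
    split=> [g x|y].
      by rewrite -fixv -[RHS]fixv; apply: eq_bigr => z _; rewrite A_act.
    rewrite -[RHS]fixv; under eq_bigr do rewrite -fixv mulr_suml.
    rewrite exchange_big; apply: eq_bigr => x _.
    by rewrite -A_K mulr_sumr; apply: eq_bigr => z _; rewrite mulrA.
  rewrite appE (eq_bigr (fun=> v y)) => [|g _].
    by rewrite sumr_const -cardsT -[v y *+ _]mulr_natl mulKf.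
  rewrite -[RHS]vK [RHS](sum_act _ g); apply: eq_bigr => x _.
  by rewrite inv_v.
have idemA x z : \sum_y A x y * A y z = A x z.
  by move: z; apply/fixAP; split=> [g y|y]; [apply: A_act | apply: A_K].
have [d dimd trd] := has_dim_idempotent idemA.
exists d; last first.
  rewrite trd exchange_big mulr_sumr; exact: eq_bigr.
have [f [lin_f inj_f rng_f]] := dimd; exists f; split=> // v.
by rewrite -fixAP; apply: rng_f.
Qed.

End InvariantDimension.

(** * Raising operators on words *)

Section RaisingOperators.
Variables (F : fieldType) (P : finType) (r : nat).
Hypothesis charF0 : [pchar F] =i pred0.
Notation word := {ffun P -> 'I_r}.
Implicit Types (v : word -> F) (w : word) (S : {set P}).

Definition subst_letter w (p : P) (j : 'I_r) : word :=
  [ffun x => if x == p then j else w x].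

Definition count_letter S w (i : 'I_r) := #|[set p in S | w p == i]|.

(** The transpose of the operator that replaces, in all ways, one letter [i] at a
    position of [S] by [j]; on coefficient functions it lowers the letter [j] to [i].
    Restricting the positions to [S] lets it act on part of a word. *)
Definition raise S (i j : 'I_r) v w : F :=
  \sum_(p in S | w p == i) v (subst_letter w p j).

Lemma subst_letter_id w p i j :
  w p = i -> subst_letter (subst_letter w p j) p i = w.
Proof. by move=> wp; apply/ffunP=> x; rewrite !ffunE; case: eqP => // ->. Qed.

Lemma subst_letter_eq w w' p i j :
  (w p == i) && (w' == subst_letter w p j) = (w' p == j) && (subst_letter w' p i == w).
Proof.
apply/andP/andP => [[/eqP wp /eqP->] | [/eqP wp /eqP<-]].
  by rewrite ffunE subst_letter_id ?eqxx.
by rewrite ffunE subst_letter_id ?eqxx.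
Qed.

Lemma subst_letterC w p q i j : p != q ->
  subst_letter (subst_letter w p j) q i = subst_letter (subst_letter w q i) p j.
Proof.
move=> ne_pq; apply/ffunP=> x; rewrite !ffunE; case: eqP => // ->.
by rewrite eq_sym (negPf ne_pq).
Qed.

Lemma count_subst S w p i j : p \in S -> w p = j -> i != j ->
  count_letter S (subst_letter w p i) i = (count_letter S w i).+1
  /\ count_letter S w j = (count_letter S (subst_letter w p i) j).+1.
Proof.
move=> Sp wp ne_ij; rewrite /count_letter; split.
  rewrite (cardsD1 p) inE Sp ffunE !eqxx; congr _.+1.
  apply: eq_card => x; rewrite !inE ffunE; case: eqP => //= ->.
  by rewrite wp eq_sym (negPf ne_ij) andbF.
rewrite (cardsD1 p) inE Sp wp eqxx; congr _.+1.
apply: eq_card => x; rewrite !inE ffunE; case: eqP => //= ->.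
by rewrite (negPf ne_ij) andbF.
Qed.

Lemma raise_raise S i j v w : i != j ->
  raise S i j (raise S j i v) w =
    (count_letter S w i)%:R * v w
    + \sum_(p in S | w p == i) \sum_(q in S | w q == j)
        v (subst_letter (subst_letter w p j) q i).
Proof.
move=> ne_ij; rewrite /raise mulr_natl /count_letter -sumr_const.
under [X in _ = X + _]eq_bigl do rewrite inE.
rewrite -big_split; apply: eq_bigr => p /andP[Sp /eqP wp].
rewrite (bigD1 p) /=; last by rewrite Sp ffunE !eqxx.
rewrite subst_letter_id //; congr (_ + _); apply: eq_bigl => q.
rewrite ffunE; have [->|_] := eqVneq q p; last by rewrite andbT.
by rewrite wp (negPf ne_ij) !andbF.
Qed.

(** The relation [[E, F] = H] of sl2: the terms moving two distinct positions
    cancel. *)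
Lemma raise_comm S i j v w : i != j ->
  raise S i j (raise S j i v) w = raise S j i (raise S i j v) w
    + ((count_letter S w i)%:R - (count_letter S w j)%:R) * v w.
Proof.
move=> ne_ij; have ne_ji : j != i by rewrite eq_sym.
rewrite !raise_raise // [in LHS]exchange_big /=.
rewrite (eq_bigr (fun q => \sum_(p in S | w p == i)
  v (subst_letter (subst_letter w q i) p j))) => [|q /andP[_ /eqP wq]]; first by ring.
apply: eq_bigr => p /andP[_ /eqP wp]; rewrite subst_letterC //.
by apply: contraNneq ne_ij => eq_pq; rewrite -wp -wq eq_pq.
Qed.

Lemma raiseZ S i j c v v' w : (forall w', v w' = c * v' w') ->
  raise S i j v w = c * raise S i j v' w.
Proof. by move=> vE; rewrite /raise mulr_sumr; apply: eq_bigr. Qed.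

(** The representation theory of sl2: with [E], [F] the raising and lowering
    operators, [E F^(m+1) v = (m+1)(a-b-m) F^m v]; for [a < b] the scalar never
    vanishes, contradicting the nilpotency of [F]. *)
Lemma highest_weight_leq S i j v a b : i != j ->
    (forall w, v w != 0 -> count_letter S w i = a /\ count_letter S w j = b) ->
    (forall w, raise S i j v w = 0) -> (exists w, v w != 0) -> (b <= a)%N.
Proof.
move=> ne_ij wt_v Ev [w0 nzv]; rewrite leqNgt; apply/negP => lt_ab.
pose V m := iter m (raise S j i) v.
have wt_V m w : V m w != 0 ->
    (count_letter S w i + m)%N = a /\ count_letter S w j = (b + m)%N.
  elim: m w => [|m IH] w; first by rewrite !addn0; apply: wt_v.
  rewrite /V iterS -/(V m) {1}/raise => nz.
  have [p /andP[/andP[Sp /eqP wp] nzp]] : exists p, (p \in S) && (w p == j)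
      && (V m (subst_letter w p i) != 0).
    apply/existsP; apply: contraR nz => /existsPn all0.
    rewrite big1 // => p Pp; apply/eqP; move: (all0 p).
    by rewrite Pp negbK.
  have [<- ] := IH _ nzp; have [-> ->] := count_subst Sp wp ne_ij.
  by move=> ->; rewrite addSn !addnS.
have EV m w : raise S i j (V m.+1) w
    = m.+1%:R * (a%:R - b%:R - m%:R) * V m w.
  elim: m w => [|m IH] w; rewrite [V _.+1]/V iterS -/(V _) raise_comm //.
    rewrite (@raiseZ S j i 0 _ v) => [|w']; last by rewrite Ev mul0r.
    rewrite mul0r add0r; have [->|/wt_V] := eqVneq (V 0 w) 0; first by rewrite !mulr0.
    by rewrite addn0 => -[-> ->]; rewrite addn0 subr0 mul1r.
  rewrite (raiseZ _ _ _ _ IH) -[raise S j i (V m) w]/(V m.+1 w).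
  have [->|/wt_V[<- ->]] := eqVneq (V m.+1 w) 0; first by rewrite !mulr0 addr0.
  by rewrite !natrD -!natr1; ring.
suff nzV m : exists w, V m w != 0.
  by have [w /wt_V[]] := nzV a.+1; lia.
elim: m => [|m [w nzVm]]; first by exists w0.
apply: contrapT => V0; case/eqP: nzVm.
have := EV m w; rewrite (@raiseZ S i j 0 _ v) => [|w']; last first.
  rewrite mul0r; apply/eqP; apply: contraT => nz.
  by case: V0; exists w'.
rewrite mul0r => /esym/eqP; rewrite !mulf_eq0 => /orP[|/eqP//].
have -> : a%:R - b%:R - m%:R = - (b - a + m)%:R :> F.
  by rewrite natrD natrB ?(ltnW lt_ab) //; ring.
by rewrite oppr_eq0 !((pcharf0P F).1 charF0); lia.
Qed.

End RaisingOperators.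

(** * Specht modules as spaces of highest weight vectors *)

Section Code.
Variable r : nat.

Definition digits_value n (a : nat -> nat) := (\sum_(x < n) a x * r ^ x)%N.

Lemma digits_value_lt n a : (forall x, x < n -> a x < r)%N ->
  (digits_value n a < r ^ n)%N.
Proof.
elim: n => [|n IH] lt_ar; first by rewrite /digits_value big_ord0.
rewrite /digits_value big_ord_recr /= expnS.
have {}IH : (digits_value n a < r ^ n)%N by apply: IH => x /ltnW; apply: lt_ar.
apply: (@leq_trans ((a n).+1 * r ^ n)); last by rewrite leq_mul2r lt_ar ?orbT.
by rewrite mulSn ltn_add2r.
Qed.

Lemma digits_value_mono n a b p : (p < n)%N -> (forall x, x < n -> a x < r)%N ->
    (a p < b p)%N -> (forall x, p < x < n -> a x = b x)%N ->
  (digits_value n a < digits_value n b)%N.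
Proof.
elim: n => // n IH lt_pn lt_ar lt_ab eq_ab.
rewrite /digits_value !big_ord_recr /=.
have lt_ar' x : (x < n -> a x < r)%N by move/ltnW; apply: lt_ar.
move: lt_pn; rewrite ltnS leq_eqVlt => /predU1P[eq_pn | lt_pn].
  have := digits_value_lt lt_ar'; rewrite -eq_pn => lt_v.
  apply: leq_trans (leq_addl _ _); apply: (@leq_trans ((a p).+1 * r ^ p)).
    by rewrite mulSn ltn_add2r.
  by rewrite leq_mul2r lt_ab orbT.
rewrite (eq_ab n) ?lt_pn ?ltnSn // ltn_add2r; apply: IH => // x /andP[lt_px lt_xn].
by rewrite eq_ab // lt_px ltnW.
Qed.

(** Words are compared by their last difference; reading a word as the digits
    of a number turns this order into that of natural numbers. *)
Definition code n (w : {ffun 'I_n -> 'I_r}) :=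
  digits_value n (fun x => oapp (fun o => nat_of_ord (w o)) 0%N (insub x)).

Lemma code_lt n (w w' : {ffun 'I_n -> 'I_r}) (p : 'I_n) :
  (w p < w' p)%N -> (forall x : 'I_n, (p < x)%N -> w x = w' x) ->
  (code w < code w')%N.
Proof.
move=> lt_ww' eq_ww'; apply: (digits_value_mono (p := p)) => // [x lt_xn||x].
- by rewrite insubT /=.
- by rewrite valK.
by case/andP=> lt_px lt_xn; rewrite insubT /= eq_ww'.
Qed.

Lemma code_inj n : injective (@code n).
Proof.
move=> w w' eq_code; apply/eqP; apply: contraT => ne_ww'.
have [x0 ne_x0] : exists x, w x != w' x.
  by apply/existsP; apply: contraR ne_ww' => /existsPn eqw;
    apply/eqP/ffunP=> x; apply/eqP; rewrite -[_ == _]negbK eqw.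
have [p ne_p max_p] 
  := @arg_maxnP _ x0 (fun x => w x != w' x) (fun x => nat_of_ord x) ne_x0.
have eq_above (x : 'I_n) : (p < x)%N -> w x = w' x.
  by move=> lt_px; apply/eqP; apply: contraTT lt_px => ne_x; rewrite -leqNgt; apply: max_p.
have [lt|gt|/val_inj eq_p] := ltngtP (w p) (w' p).
- by have := code_lt lt eq_above; rewrite eq_code ltnn.
- have := code_lt gt (fun x lt_px => esym (eq_above x lt_px)).
  by rewrite eq_code ltnn.
by rewrite eq_p eqxx in ne_p.
Qed.

End Code.

(** The trace on a submodule is computed by any projection onto it: two such
    projections agree on [U], and the operator keeps their images in [U]. *)
Lemma mxtrace_submod (F : fieldType) (gT : finGroupType) (G : {group gT}) n
    (rG : mx_representation F G n) (U P : 'M_n) (modU : mxmodule rG U) x :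
    x \in G -> (P <= U)%MS -> U *m P = U ->
  \tr (submod_repr modU x) = \tr (rG x *m P).
Proof.
move=> Gx sPU UP; pose B := val_submod (1%:M : 'M_(\rank U)).
pose S := in_submod U (1%:M : 'M_n).
have fixS m (W : 'M_(m, n)) : (W <= U)%MS -> W *m S *m B = W.
  by move=> sWU; rewrite /S /B -in_submodE -val_submodE in_submodK.
have fixP m (W : 'M_(m, n)) : (W <= U)%MS -> W *m P = W.
  by case/submxP=> Z ->; rewrite -mulmxA UP.
have sBU m (W : 'M_(m, _)) : (W *m B <= U)%MS.
  by apply: submx_trans (submxMl _ _) _; rewrite /B val_submod1.
transitivity (\tr (S *m B *m rG x)).
  rewrite /= /submod_mx in_submodE -/B -/S mxtrace_mulC mulmxA //.
rewrite -(fixP _ (S *m B *m rG x)); last first.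
  by apply: submx_trans (submxMr _ (sBU _ S)) _; apply: (mxmoduleP modU).
clearbody S B.
by rewrite mxtrace_mulC !mulmxA fixS // mxtrace_mulC.
Qed.

Section Tableaux.
Variables (F : fieldType) (N r : nat) (la : seq nat).
Hypothesis charF0 : [pchar F] =i pred0.
Hypothesis la_part : is_partition N la.
Hypothesis le_size : (size la <= r)%N.
Notation word := {ffun 'I_N -> 'I_r}.
Implicit Types (v : word -> F) (w : word) (t g s : 'S_N) (p d : 'I_N) (i j : 'I_r).

Lemma sumn_la : sumn la = N.
Proof. by case/and3P: la_part => _ _ /eqP. Qed.

Lemma part_nonincr i j : (i <= j)%N -> (nth 0 la j <= nth 0 la i)%N.
Proof.
case/and3P: la_part => sorted_la _ _ le_ij.
have [lt_j | ge_j] := ltnP j (size la); last by rewrite nth_default.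
apply: (sorted_leq_nth _ _ 0 sorted_la) => //.
- by move=> a b c /= h1 h2; apply: leq_trans h2 h1.
- by move=> a /=.
by rewrite inE (leq_ltn_trans le_ij).
Qed.

Lemma cell_row_subproof p : (reshape_index la p < r)%N.
Proof. by apply: leq_trans (reshape_indexP _) le_size; rewrite sumn_la. Qed.

Definition cell_row p : 'I_r := Ordinal (cell_row_subproof p).
Definition cell_col p : nat := reshape_offset la p.

Lemma cell_inj p d : cell_row p = cell_row d -> cell_col p = cell_col d -> p = d.
Proof.
move=> /(congr1 val) /= eq_row eq_col; apply/val_inj => /=.
rewrite -[LHS](reshape_indexK la) -[RHS](reshape_indexK la).
by rewrite -/(cell_col p) -/(cell_col d) eq_col eq_row.
Qed.

Lemma cell_col_lt p : (cell_col p < nth 0 la (cell_row p))%N.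
Proof. by apply: reshape_offsetP; rewrite sumn_la. Qed.

Lemma cell_exists i c : (c < nth 0 la i)%N ->
  exists p, cell_row p = i /\ cell_col p = c.
Proof.
move=> lt_c; have lt_p : (flatten_index la i c < N)%N.
  by rewrite -[N]sumn_la flatten_indexP.
exists (Ordinal lt_p); split; last by rewrite /cell_col /= flatten_indexKr.
by apply/val_inj; rewrite /= flatten_indexKl.
Qed.

Lemma card_row i : #|[set p | cell_row p == i]| = nth 0 la i.
Proof.
have /choice[f fP] (c : 'I_(nth 0 la i)) := cell_exists (ltn_ord c).
rewrite -[RHS]card_ord -(card_imset _ (f := f)) => [|c c' eq_f]; last first.
  by apply: val_inj; rewrite /= -(fP c).2 -(fP c').2 eq_f.
apply: eq_card => p; rewrite inE; apply/eqP/imsetP => [eq_i|[c _ ->]]; last exact: (fP c).1.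
have lt_c : (cell_col p < nth 0 la i)%N by rewrite -eq_i cell_col_lt.
by exists (Ordinal lt_c) => //; have [row_f col_f] := fP (Ordinal lt_c);
  apply: cell_inj; rewrite ?row_f ?col_f.
Qed.

Definition has_content w := forall i, count_letter setT w i = nth 0 la i.

Definition tableau_word t : word := [ffun x => cell_row ((t^-1)%g x)].

Definition word_act w g : word := [ffun x => w ((g^-1)%g x)].

Lemma word_act1 w : word_act w 1%g = w.
Proof. by apply/ffunP=> x; rewrite ffunE invg1 perm1. Qed.

Lemma word_actM w g h : word_act w (g * h)%g = word_act (word_act w g) h.
Proof. by apply/ffunP=> x; rewrite !ffunE invMg permM. Qed.

Lemma tableau_word_act t g : word_act (tableau_word t) g = tableau_word (t * g)%g.
Proof. by apply/ffunP=> x; rewrite !ffunE invMg permM. Qed.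

Lemma count_act w g i : count_letter setT (word_act w g) i = count_letter setT w i.
Proof.
rewrite /count_letter -[RHS](card_imset _ (@perm_inj _ g)).
apply: eq_card => x; rewrite inE ffunE; apply/idP/imsetP => [wx|[y wy ->]].
  by exists ((g^-1)%g x); [move: wx; rewrite !inE | rewrite permKV].
by rewrite permK; move: wy; rewrite !inE.
Qed.

Lemma content_act w g : has_content w -> has_content (word_act w g).
Proof. by move=> cw i; rewrite count_act. Qed.

Lemma tableau_word_content t : has_content (tableau_word t).
Proof.
move=> i; rewrite -[t]mul1g -tableau_word_act count_act -card_row.
by apply: eq_card => p; rewrite !inE ffunE invg1 perm1.
Qed.

(** The occurrences of a letter, in increasing order, fill the corresponding
    row from left to right. *)
Definition occurrence w (x : 'I_N) := #|[set y : 'I_N | (y < x)%N && (w y == w x)]|.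

Lemma content_tableau w : has_content w -> exists t,
  tableau_word t = w /\ forall x, cell_col ((t^-1)%g x) = occurrence w x.
Proof.
move=> cw; have lt_occ x : (occurrence w x < nth 0 la (w x))%N.
  rewrite -cw /count_letter [X in (_ < X)%N](cardsD1 x) !inE eqxx ltnS.
  apply/subset_leq_card/subsetP=> y; rewrite !inE => /andP[lt_yx ->].
  by rewrite !andbT; apply: contraTneq lt_yx => ->; rewrite ltnn.
have /choice[f fP] x := cell_exists (lt_occ x).
have occ_mono (x y : 'I_N) : (x < y)%N -> w x = w y -> (occurrence w x < occurrence w y)%N.
  move=> lt_xy eq_w; rewrite /occurrence [X in (_ < X)%N](cardsD1 x) !inE lt_xy eq_w.
  rewrite eqxx ltnS; apply/subset_leq_card/subsetP=> z; rewrite !inE.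
  case/andP=> lt_zx ->; rewrite (ltn_trans lt_zx) // !andbT.
  by apply: contraTneq lt_zx => ->; rewrite ltnn.
have f_inj : injective f.
  move=> x y eq_f; have [row_x col_x] := fP x; have [row_y col_y] := fP y.
  have eq_w : w x = w y by rewrite -row_x eq_f.
  have eq_occ : occurrence w x = occurrence w y by rewrite -col_x eq_f.
  apply: val_inj; case: (ltngtP x y) => // lt.
    by have := occ_mono _ _ lt eq_w; rewrite eq_occ ltnn.
  by have := occ_mono _ _ lt (esym eq_w); rewrite eq_occ ltnn.
exists (perm f_inj)^-1%g; split=> [|x]; last by rewrite invgK permE; case: (fP x).
by apply/ffunP=> x; rewrite ffunE invgK permE; case: (fP x).
Qed.

Lemma col_stabP s : reflect (forall p, cell_col (s p) = cell_col p) (s \in col_stab N la).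
Proof. by rewrite inE; apply: (iffP forallP) => h p; apply/eqP; apply: h. Qed.

Lemma col_stabM s s' : s \in col_stab N la -> s' \in col_stab N la ->
  (s * s')%g \in col_stab N la.
Proof. by move=> /col_stabP h /col_stabP h'; apply/col_stabP=> p; rewrite permM h' h. Qed.

Lemma col_stab1 : 1%g \in col_stab N la.
Proof. by apply/col_stabP=> p; rewrite perm1. Qed.

Lemma col_stabV s : s \in col_stab N la -> (s^-1)%g \in col_stab N la.
Proof. by move=> /col_stabP h; apply/col_stabP=> p; rewrite -h permKV. Qed.

Lemma col_stab_tperm p d : cell_col p = cell_col d -> tperm p d \in col_stab N la.
Proof. by move=> eq_c; apply/col_stabP=> x; case: tpermP => // ->. Qed.

Lemma sum_col_stab (s0 : 'S_N) (f : 'S_N -> F) : s0 \in col_stab N la ->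
  \sum_(s in col_stab N la) f s = \sum_(s in col_stab N la) f (s0 * s)%g.
Proof.
move=> Cs0; rewrite (reindex_inj (mulgI s0)); apply: eq_bigl => s.
by apply/idP/idP => [/(col_stabM (col_stabV Cs0))|/(col_stabM Cs0)]; rewrite ?mulKg.
Qed.

(** The polytabloid of [t], read in the basis of words. *)
Definition poly_word t : word -> F := fun w =>
  \sum_(s in col_stab N la) (-1) ^+ odd_perm s * (tableau_word (s * t)%g == w)%:R.

Lemma poly_word_content t w : poly_word t w != 0 -> has_content w.
Proof.
move=> nz; apply: contrapT => ncw; case/eqP: nz; apply: big1 => s _.
by case: eqP => [eq_w|_]; [case: ncw; rewrite -eq_w; apply: tableau_word_content
  | rewrite mulr0].
Qed.

(** A transposition of two cells of one column is odd and lies in the column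
    stabiliser, so a signed sum that it preserves equals its opposite. *)
Lemma sum_signed_eq0 p d (f : 'S_N -> F) : p != d -> cell_col p = cell_col d ->
    (forall s, f (tperm p d * s)%g = f s) ->
  \sum_(s in col_stab N la) (-1) ^+ odd_perm s * f s = 0.
Proof.
move=> ne_pd eq_c f_tperm; set S := LHS.
have : S = - S.
  rewrite {1}/S (sum_col_stab _ (col_stab_tperm eq_c)) -sumrN.
  apply: eq_bigr => s _; rewrite f_tperm odd_permM odd_tperm ne_pd.
  by rewrite signrN mulNr.
have nz2 : 2%:R != 0 :> F by rewrite natr_char0_neq0.
by move/eqP; rewrite -addr_eq0 -mulr2n -mulr_natr mulf_eq0 (negPf nz2) orbF => /eqP.
Qed.

(** Raising a letter of a signed sum over a column stabiliser creates two equal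
    letters in one column, so the terms cancel in pairs. *)
Lemma raise_poly_word t i j w : (i < j)%N -> raise setT i j (poly_word t) w = 0.
Proof.
move=> lt_ij; rewrite /raise /poly_word exchange_big /=.
pose f d s : F :=
  (subst_letter (tableau_word (s * t)%g) ((s * t)%g d) i == w)%:R.
transitivity (\sum_(s in col_stab N la) \sum_(d | cell_row d == j)
    (-1) ^+ odd_perm s * f d s).
  apply: eq_bigr => s _; rewrite (reindex_inj (@perm_inj _ (s * t)%g)) /=.
  rewrite -!mulr_sumr [in LHS]big_mkcond [in RHS]big_mkcond /=; congr (_ * _).
  apply: eq_bigr => d _; rewrite inE /= /f; set T := tableau_word _.
  have rowE : T ((s * t)%g d) = cell_row d by rewrite ffunE permK.
  have := subst_letter_eq w T ((s * t)%g d) i j; rewrite rowE.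
  by case: (w _ == i); case: (T == _); case: (cell_row d == j);
    case: (subst_letter _ _ _ == w).
rewrite exchange_big big1 // => d /eqP row_d.
have lt_c : (cell_col d < nth 0 la i)%N.
  by apply: leq_trans (cell_col_lt d) _; rewrite row_d part_nonincr // ltnW.
have [d' [row_d' col_d']] := cell_exists lt_c.
have ne_d : d' != d.
  by apply: contraTneq lt_ij => eq_d; rewrite -row_d -row_d' eq_d ltnn.
apply: (sum_signed_eq0 ne_d col_d') => s; rewrite /f; congr (_ == _)%:R.
rewrite -mulgA; move: (s * t)%g => u; apply/ffunP=> x; rewrite !ffunE.
rewrite !permM tpermR invMg tpermV permM.
rewrite -[x](permKV u); move: (u^-1%g x) => y.
rewrite !(inj_eq perm_inj) permK.
case: tpermP => [->|->|/eqP ne1 /eqP ne2].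
- by rewrite eqxx row_d' if_same.
- by rewrite eqxx row_d' if_same.
by rewrite (negPf ne1) (negPf ne2).
Qed.

(** The highest weight vectors of weight [la] for the general linear Lie algebra
    acting on the letters. *)
Definition highest v :=
  (forall w, v w != 0 -> has_content w)
  /\ forall i j, (i < j)%N -> forall w, raise setT i j v w = 0.

Lemma highest_poly_word t : highest (poly_word t).
Proof.
by split=> [w|i j lt_ij w]; [apply: poly_word_content | apply: raise_poly_word].
Qed.

Section LeadingWord.
Variables (v : word -> F) (w0 : word).
Hypothesis highest_v : highest v.
Hypothesis nz_w0 : v w0 != 0.
Hypothesis max_w0 : forall w, v w != 0 -> (code w <= code w0)%N.

Let prefix m := [set x : 'I_N | (x < m)%N].

(** Fixing the letters after position [m] as in the leading word yields a vector
    still killed by the raising operators on the first [m] positions: raising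
    a fixed letter instead would give a larger word. *)
Lemma leading_lattice m i j : (i < j)%N ->
  (count_letter (prefix m) w0 j <= count_letter (prefix m) w0 i)%N.
Proof.
move=> lt_ij; have ne_ij : i != j by apply: contraTneq lt_ij => ->; rewrite ltnn.
pose agree w := [forall x, (x \notin prefix m) ==> (w x == w0 x)].
have agreeP w : reflect (forall x, x \notin prefix m -> w x = w0 x) (agree w).
  by apply: (iffP forallP) => h x; [move=> nx; apply/eqP; move: (h x); rewrite nx
    | apply/implyP=> nx; apply/eqP/h].
pose v' w := if agree w then v w else 0.
have [content_v raise_v] := highest_v.
apply: (@highest_weight_leq _ _ _ charF0 (prefix m) i j v' _ _ ne_ij).
- move=> w; rewrite /v'; case: agreeP => [agr nzw|_]; last by rewrite eqxx.
  have split_count u k : count_letter setT u k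
      = (count_letter (prefix m) u k + #|[set x | (x \notin prefix m) && (u x == k)]|)%N.
    rewrite /count_letter -cardsUI [X in (_ + X)%N](_ : _ = 0%N); last first.
      by apply: eq_card0 => x; rewrite !inE; case: (x < m)%N; rewrite ?andbF.
    by rewrite addn0; apply: eq_card => x; rewrite !inE; case: (x < m)%N => //=; rewrite orbF.
  have same k : count_letter (prefix m) w k = count_letter (prefix m) w0 k.
    have := content_v _ nzw k; rewrite -(content_v _ nz_w0 k) !split_count.
    rewrite (_ : [set x | (x \notin prefix m) && (w x == k)]
                 = [set x | (x \notin prefix m) && (w0 x == k)]) => [/addIn //|].
    apply/setP=> x; rewrite [LHS]inE [RHS]inE.
    by case nx: (x \notin prefix m) => //=; rewrite agr.
  by rewrite !same.
- move=> w; have [agr|nagr] := agreeP w; last first.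
    apply: big1 => p /andP[Sp _]; rewrite /v'; case: agreeP => // agr'.
    case: nagr => x nx; rewrite -agr' // ffunE; case: eqP => // eq_x.
    by rewrite eq_x Sp in nx.
  transitivity (raise setT i j v w); last exact: raise_v.
  rewrite /raise [RHS](bigID (mem (prefix m))) /= [X in _ = _ + X]big1 ?addr0.
    apply: eq_big => [p|p /andP[Sp wp]]; first by rewrite !inE andbC.
    rewrite /v'; case: agreeP => // nagr'; case: nagr' => x nx.
    rewrite ffunE -agr //; case: eqP => // eq_x.
    by rewrite eq_x Sp in nx.
  move=> p /andP[/andP[_ /eqP wp] nSp]; apply/eqP; apply: contraT => nz.
  have := max_w0 nz; rewrite leqNgt => /negP; case.
  apply: (code_lt (p := p)); first by rewrite ffunE eqxx -agr // wp.
  move=> x lt_px; rewrite ffunE; case: eqP => [eq_x|_].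
    by rewrite eq_x ltnn in lt_px.
  rewrite agr // inE -leqNgt; move: nSp; rewrite inE -leqNgt => le_mp.
  exact: leq_trans le_mp (ltnW lt_px).
by exists w0; rewrite /v'; case: agreeP.
Qed.

(** By the lattice property, numbering the occurrences of each letter makes the
    leading word a standard tableau; a column permutation then moves its largest
    displaced entry to a higher row, which makes the word smaller. *)
Lemma leading_tableau : exists t,
  poly_word t w0 = 1 /\ forall w, poly_word t w != 0 -> w = w0 \/ (code w < code w0)%N.
Proof.
have [t [word_t col_t]] := content_tableau (highest_v.1 _ nz_w0).
have w0E x : w0 x = cell_row ((t^-1)%g x) by rewrite -word_t ffunE.
(* Columns increase: at [y], the letter of the upper row has occurred as often. *)
have standard x y : cell_col ((t^-1)%g x) = cell_col ((t^-1)%g y) ->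
    (w0 x < w0 y)%N -> (x < y)%N.
  rewrite !col_t => eq_occ lt_w; rewrite ltnNge leq_eqVlt; apply/negP => /orP[|lt_yx].
    by move/eqP/val_inj => eq_xy; rewrite eq_xy ltnn in lt_w.
  have := leading_lattice y.+1 lt_w; rewrite leqNgt => /negP; case.
  apply: (@leq_ltn_trans (occurrence w0 x)).
    apply/subset_leq_card/subsetP=> z; rewrite !inE ltnS => /andP[le_zy ->].
    by rewrite andbT (leq_ltn_trans le_zy).
  rewrite eq_occ /count_letter [X in (_ < X)%N](cardsD1 y) !inE ltnSn eqxx ltnS.
  apply/subset_leq_card/subsetP=> z; rewrite !inE => /andP[lt_zy ->].
  rewrite ltnS (ltnW lt_zy) !andbT.
  by apply: contraTneq lt_zy => ->; rewrite ltnn.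
have lt_code s : s \in col_stab N la -> s != 1%g ->
    (code (tableau_word (s * t)%g) < code w0)%N.
  move=> /col_stabV/col_stabP col_s ne_s.
  have [x0 ne_x0] : exists x, (s^-1)%g ((t^-1)%g x) != (t^-1)%g x.
    apply/existsP; apply: contraR ne_s => /existsPn fix_s.
    rewrite -invg_eq1; apply/eqP/permP=> p; rewrite perm1.
    by have := fix_s (t p); rewrite permK negbK => /eqP.
  have [x ne_x max_x] := @arg_maxnP _ x0
    (fun x => (s^-1)%g ((t^-1)%g x) != (t^-1)%g x) (fun x => nat_of_ord x) ne_x0.
  have fix_above (y : 'I_N) : (x < y)%N -> (s^-1)%g ((t^-1)%g y) = (t^-1)%g y.
    by move=> lt_xy; apply/eqP; apply: contraTT lt_xy => ne_y; rewrite -leqNgt; apply: max_x.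
  apply: (code_lt (p := x)) => [|y lt_xy]; rewrite ffunE invMg permM; last first.
    by rewrite fix_above // w0E.
  rewrite w0E; set d := (t^-1)%g x in ne_x *; set d' := (s^-1)%g d in ne_x *.
  have [//|gt|/val_inj eq_row] := ltngtP (cell_row d') (cell_row d); last first.
    by rewrite (cell_inj eq_row (col_s d)) eqxx in ne_x.
  have lt_xt : (x < t d')%N.
    by apply: standard; rewrite ?w0E permK // /d' col_s.
  have := fix_above _ lt_xt; rewrite permK => /perm_inj eq_d.
  by rewrite eq_d eqxx in ne_x.
exists t; split.
  rewrite /poly_word (bigD1 1%g) ?col_stab1 //= odd_perm1 mul1g word_t eqxx mulr1.
  rewrite big1 ?addr0 // => s /andP[Cs ne_s]; case: eqP => [eq_w|]; last by rewrite mulr0.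
  by have := lt_code s Cs ne_s; rewrite eq_w ltnn.
move=> w nz; have [s [Cs eq_w]] :
    exists s, s \in col_stab N la /\ tableau_word (s * t)%g = w.
  apply: contrapT => none; case/eqP: nz; apply: big1 => s Cs.
  by case: eqP => [eq_w|]; [case: none; exists s | rewrite mulr0].
have [eq_s|ne_s] := eqVneq s 1%g; first by left; rewrite -eq_w eq_s mul1g.
by right; rewrite -eq_w lt_code.
Qed.

End LeadingWord.

Lemma highest_linear a u v : highest u -> highest v -> highest (fun w => a * u w + v w).
Proof.
move=> [cu ru] [cv rv]; split=> [w nz|i j lt_ij w].
  apply: contrapT => ncw; case/eqP: nz.
  have [->|/cu//] := eqVneq (u w) 0; have [->|/cv//] := eqVneq (v w) 0.
  by rewrite mulr0 addr0.
by rewrite /raise big_split /= -mulr_sumr -!/(raise _ _ _ _ _) ru // rv // mulr0 addr0.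
Qed.

(** Leading words are eliminated one after the other by subtracting polytabloids,
    which are themselves highest weight vectors. *)
Lemma highest_span v : highest v ->
  exists c : 'S_N -> F, forall w, v w = \sum_t c t * poly_word t w.
Proof.
suff span_bounded m u : highest u -> (forall w, u w != 0 -> (code w < m)%N) ->
    exists c : 'S_N -> F, forall w, u w = \sum_t c t * poly_word t w.
  move=> high_v; apply: (span_bounded (\max_w code w).+1) => // w _.
  by rewrite ltnS; apply: leq_bigmax.
elim: m u => [|m IH] u high_u lt_u.
  exists (fun=> 0) => w; rewrite big1 => [|t _]; last by rewrite mul0r.
  by apply/eqP; apply: contraT => /lt_u.
have [[w0 [nz_w0 code_w0]] | none] := pselect (exists w, u w != 0 /\ code w = m); last first.
  apply: IH => // w nz; have := lt_u w nz; rewrite ltnS leq_eqVlt => /predU1P[eq_m|//].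
  by case: none; exists w.
have max_w0 w : u w != 0 -> (code w <= code w0)%N by rewrite code_w0; apply: lt_u.
have [t [t_w0 lt_t]] := leading_tableau high_u nz_w0 max_w0.
have [|w nz|c cE] := IH (fun w => - u w0 * poly_word t w + u w).
- exact: highest_linear (highest_poly_word t) high_u.
- have ne_w : w != w0.
    by apply: contraNneq nz => ->; rewrite t_w0 mulr1 addNr.
  have : (code w <= code w0)%N.
    have [u0|/max_w0//] := eqVneq (u w) 0.
    have : poly_word t w != 0 by apply: contraNneq nz => ->; rewrite u0 mulr0 addr0.
    by case/lt_t=> [->|/ltnW].
  rewrite code_w0 leq_eqVlt => /predU1P[eq_m|//].
  by case/eqP: ne_w; apply: code_inj; rewrite eq_m code_w0.
exists (fun s => c s + (s == t)%:R * u w0) => w.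
under eq_bigr do rewrite mulrDl.
rewrite big_split -cE /= (bigD1 t) //= eqxx mul1r big1 => [|s /negPf->]; last first.
  by rewrite !mul0r.
by rewrite addr0 mulNr addrAC addNr add0r.
Qed.

(** Counting the letters below a row that column [c] avoids: no column can hold
    more letters below [m] than cells in the first [m] rows, so equality of the
    totals forces every cell [(u d, c)] with [d] in column [c] to exist. *)
Lemma column_injective_cells (u : word) : has_content u ->
    (forall p d, cell_col p = cell_col d -> u p = u d -> p = d) ->
  forall d, (cell_col d < nth 0 la (u d))%N.
Proof.
move=> cu col_inj d0; rewrite ltnNge; apply/negP => out_d0.
set m := nat_of_ord (u d0) in out_d0.
have lt_colN d : (cell_col d < N)%N by apply: leq_ltn_trans (leq_subr _ _) (ltn_ord d).
pose coln d : 'I_N := Ordinal (lt_colN d).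
have total (f : 'I_N -> 'I_r) : (forall i, #|[set d | f d == i]| = nth 0 la i) ->
    (\sum_d (f d < m) = \sum_(i < r | i < m) nth 0 la i)%N.
  move=> card_f; rewrite (partition_big f xpredT) //= [RHS]big_mkcond /=.
  apply: eq_bigr => i _; rewrite (eq_bigr (fun=> (i < m)%N : nat)) => [|d /eqP-> //].
  rewrite sum_nat_const -card_f; have -> : #|[pred d | f d == i]| = #|[set d | f d == i]|.
    by apply: eq_card => d; rewrite !inE.
  by case: (i < m)%N; rewrite ?muln1 ?muln0.
have eq_total : (\sum_d (u d < m) = \sum_d (cell_row d < m))%N.
  rewrite !total // => [i|i]; first exact: card_row.
  by rewrite -(cu i); apply: eq_card => d; rewrite !inE.
have all_below i c d : (nth 0 la i <= c)%N -> cell_col d = c -> (cell_row d < i)%N.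
  move=> le_c col_d; rewrite ltnNge; apply/negP => le_i.
  have := cell_col_lt d; rewrite ltnNge col_d => /negP; case.
  by apply: leq_trans le_c; apply: part_nonincr.
move: eq_total; rewrite (partition_big coln xpredT) //= [RHS](partition_big coln xpredT) //=.
apply/eqP; rewrite neq_ltn; apply/orP; left.
have le_col c : (\sum_(d | coln d == c) (u d < m) <= \sum_(d | coln d == c) (cell_row d < m))%N.
  (* Either column [c] ends above row [m], so that all its cells count on the right. *)
  have [allc | /existsPn allc] := boolP [exists i : 'I_r, (i < m)%N && (nth 0 la i <= c)%N].
    have /existsP[i /andP[lt_im le_c]] := allc.
    apply: leq_sum => d /eqP eq_c; have -> : (cell_row d < m)%N.
      by apply: ltn_trans (all_below i c d le_c _) lt_im; rewrite -eq_c.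
    exact: leq_b1.
  have lt_c i : (i < m)%N -> (c < nth 0 la i)%N -> exists p, cell_row p = i /\ cell_col p = c.
    by move=> _; apply: cell_exists.
  have /choice[g gP] i : exists p, (i < m)%N -> cell_row p = i /\ cell_col p = c.
    have [lt_im | ge_im] := boolP (i < m)%N; last by exists d0.
    have : (c < nth 0 la i)%N by have := allc i; rewrite lt_im /= -ltnNge.
    by move=> /(lt_c i lt_im)[p pP]; exists p.
  (* All cells [(i, c)] with [i < m] exist, and [d |-> (u d, c)] maps into them. *)
  rewrite -!big_mkcondr /= !sum1_card.
  rewrite -(card_in_imset (f := fun d => g (u d))
    (D := [pred d | (coln d == c) && (u d < m)%N])) => [|d d'].
    apply/subset_leq_card/subsetP=> _ /imsetP[d + ->]; rewrite !inE => /andP[_ lt_um].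
    have [row_g col_g] := gP _ lt_um.
    apply/andP; split; first by apply/eqP/val_inj.
    by move/(congr1 val): row_g => /= ->.
  rewrite !inE => /andP[/eqP col_d lt_d] /andP[/eqP col_d' lt_d'] eq_g.
  apply: col_inj; first by have := congr1 val col_d; have := congr1 val col_d' => /= -> ->.
  by rewrite -(gP _ lt_d).1 eq_g (gP _ lt_d').1.
(* In the column of [d0] the inequality is strict: [d0] counts only on the right. *)
rewrite (bigD1 (coln d0)) //= [X in (_ < X)%N](bigD1 (coln d0)) //=.
rewrite -addSn leq_add //; last by apply: leq_sum => c _; apply: le_col.
rewrite [X in (X < _)%N](bigD1 d0) //= [X in (_ < X)%N](bigD1 d0) //=.
rewrite ltnn add0n (all_below (u d0) (cell_col d0)) // add1n ltnS.
apply: leq_sum => d /andP[/eqP/(congr1 val) /= col_d _].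
by rewrite (all_below (u d0) (cell_col d0)) ?leq_b1.
Qed.

(** Either two equal letters in one column make the terms cancel in pairs, or a
    column permutation carries [u] to the word of the tableau 1. *)
Lemma column_antisym_cells (u : word) : has_content u ->
  exists c : F, forall w,
    \sum_(s in col_stab N la) (-1) ^+ odd_perm s * (word_act u s == w)%:R
      = c * poly_word 1%g w.
Proof.
move=> cu; have [[p [d [ne_pd eq_c eq_u]]] | no_rep] := pselect (exists p d,
    [/\ p != d, cell_col p = cell_col d & u p = u d]).
  exists 0 => w; rewrite mul0r.
  apply: (sum_signed_eq0 (f := fun s => (word_act u s == w)%:R) ne_pd eq_c) => s.
  rewrite word_actM; congr ((word_act _ _ == _)%:R).
  by apply/ffunP=> x; rewrite ffunE tpermV; case: tpermP => [->|->|].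
have col_inj p d : cell_col p = cell_col d -> u p = u d -> p = d.
  move=> eq_c eq_u; apply/eqP; apply: contraT => ne_pd.
  by case: no_rep; exists p, d.
have /choice[f fP] d := cell_exists (column_injective_cells cu col_inj d).
have f_inj : injective f.
  move=> p d eq_f; apply: col_inj; first by rewrite -(fP p).2 -(fP d).2 eq_f.
  by rewrite -(fP p).1 -(fP d).1 eq_f.
pose s0 := perm f_inj.
have Cs0 : s0 \in col_stab N la by apply/col_stabP=> d; rewrite permE (fP d).2.
have uE : u = tableau_word s0^-1%g.
  by apply/ffunP=> d; rewrite ffunE invgK permE (fP d).1.
exists ((-1) ^+ odd_perm s0) => w; rewrite (sum_col_stab _ Cs0) /poly_word mulr_sumr.
apply: eq_bigr => s _; rewrite uE tableau_word_act mulKg mulg1 odd_permM.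
by rewrite signr_addb mulrA.
Qed.

Lemma word_act_inj g : injective (fun w => word_act w g).
Proof. by move=> w w' /(congr1 (word_act^~ g^-1%g)); rewrite -!word_actM mulgV !word_act1. Qed.

Lemma word_actK w g : word_act (word_act w g) g^-1%g = w.
Proof. by rewrite -word_actM mulgV word_act1. Qed.

Lemma word_act_eq w g w' : (word_act w g == w') = (w == word_act w' g^-1%g).
Proof. by rewrite -[w in RHS](word_actK _ g) (inj_eq (@word_act_inj _)). Qed.

Lemma poly_word_act t g w : poly_word (t * g)%g (word_act w g) = poly_word t w.
Proof.
apply: eq_bigr => s _; rewrite mulgA -tableau_word_act.
by rewrite (inj_eq (@word_act_inj g)).
Qed.

Lemma column_antisym t (u : word) : has_content u ->
  exists c : F, forall w,
    \sum_(s in col_stab N la) (-1) ^+ odd_perm s * (word_act u (s ^ t)%g == w)%:R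
      = c * poly_word t w.
Proof.
move=> cu; have [c cE] := column_antisym_cells (content_act t^-1%g cu).
exists c => w; rewrite -(poly_word_act t t^-1%g) mulgV -cE; apply: eq_bigr => s _.
by rewrite /conjg mulgA !word_actM [in LHS]word_act_eq.
Qed.

Lemma poly_word_antisym t s w : s \in col_stab N la ->
  poly_word t (word_act w (s ^ t)%g) = (-1) ^+ odd_perm s * poly_word t w.
Proof.
move=> Cs; rewrite /poly_word mulr_sumr.
have -> (f : 'S_N -> F) : \sum_(s in col_stab N la) f s
    = \sum_(s' in col_stab N la) f (s' * s)%g.
  rewrite (reindex_inj (mulIg s)); apply: eq_bigl => s'.
  apply/idP/idP => [h|h]; last exact: col_stabM.
  by have := col_stabM h (col_stabV Cs); rewrite mulgK.
apply: eq_bigr => s' _; rewrite eq_sym word_act_eq eq_sym -conjVg tableau_word_act.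
have -> : (s' * s * t * s^-1 ^ t = s' * t)%g.
  by rewrite conjgE !mulgA mulgK mulgK.
by rewrite odd_permM signr_addb mulrA [(-1) ^+ _ * (-1) ^+ _]mulrC.
Qed.

(** An equivariant operator preserves the antisymmetry of a polytabloid under
    its column stabiliser, hence sends it to a multiple of itself. *)
Lemma equivariant_poly_word (T : word -> word -> F) :
    (forall g w w', T (word_act w g) (word_act w' g) = T w w') ->
    (forall w w', T w w' != 0 -> has_content w') ->
  exists c, forall t w', \sum_w poly_word t w * T w w' = c * poly_word t w'.
Proof.
move=> T_act T_content; pose u t w' := \sum_w poly_word t w * T w w'.
have u_act t g w' : u (t * g)%g (word_act w' g) = u t w'.
  rewrite /u (reindex_inj (@word_act_inj g)); apply: eq_bigr => w _.
  by rewrite poly_word_act T_act.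
have u_antisym t s w' : s \in col_stab N la ->
    u t (word_act w' (s ^ t)%g) = (-1) ^+ odd_perm s * u t w'.
  move=> Cs; rewrite /u (reindex_inj (@word_act_inj (s ^ t)%g)) mulr_sumr.
  by apply: eq_bigr => w _; rewrite poly_word_antisym // T_act mulrA.
have u_content t w' : u t w' != 0 -> has_content w'.
  move=> nz; apply: contrapT => ncw; case/eqP: nz; apply: big1 => w _.
  by have [->|/T_content//] := eqVneq (T w w') 0; rewrite mulr0.
have nzC : #|col_stab N la|%:R != 0 :> F.
  by rewrite natr_char0_neq0 // -lt0n; apply/card_gt0P; exists 1%g; apply: col_stab1.
have /choice[c cE] w0 : exists c : F, has_content w0 -> forall w,
    \sum_(s in col_stab N la) (-1) ^+ odd_perm s * (word_act w0 (s ^ 1)%g == w)%:R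
      = c * poly_word 1%g w.
  have [/(column_antisym 1%g)[c cE] | ncw] := pselect (has_content w0); last by exists 0.
  by exists c.
pose k := #|col_stab N la|%:R^-1 * \sum_w0 u 1%g w0 * c w0.
suff u1 w' : u 1%g w' = k * poly_word 1%g w'.
  exists k => t w'; rewrite -/(u t w') -(u_act t t^-1%g) mulgV u1.
  by rewrite -[in RHS](poly_word_act t t^-1%g) mulgV.
apply: (mulfI nzC); rewrite mulrA /k mulVKf //.
transitivity (\sum_(s in col_stab N la) (-1) ^+ odd_perm s * u 1%g (word_act w' (s^-1 ^ 1)%g)).
  rewrite mulr_natl -sumr_const; apply: eq_bigr => s Cs.
  by rewrite u_antisym ?col_stabV // odd_permV mulrA -signr_addb addbb mul1r.
rewrite mulr_suml.
transitivity (\sum_w0 u 1%g w0 *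
   \sum_(s in col_stab N la) (-1) ^+ odd_perm s * (word_act w0 (s ^ 1)%g == w')%:R).
  under [RHS]eq_bigr do rewrite mulr_sumr.
  rewrite exchange_big; apply: eq_bigr => s _.
  rewrite (bigD1 (word_act w' (s^-1 ^ 1)%g)) //= word_act_eq conjVg eqxx mulr1.
  rewrite [LHS]mulrC big1 ?addr0 // => w0 ne_w0.
  by rewrite word_act_eq (negPf ne_w0) !mulr0.
apply: eq_bigr => w0 _; have [->|nz] := eqVneq (u 1%g w0) 0; first by rewrite !mul0r.
by rewrite cE ?mulrA //; apply: u_content nz.
Qed.

Lemma poly_word_diag t : poly_word t (tableau_word t) = 1.
Proof.
rewrite /poly_word (bigD1 1%g) ?col_stab1 //= odd_perm1 mul1g eqxx mulr1.
rewrite big1 ?addr0 // => s /andP[/col_stabP col_s ne_s].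
case: eqP => [eq_w|_]; last by rewrite mulr0.
case/eqP: ne_s; apply/permP=> p; rewrite perm1; apply: cell_inj => //.
have := congr1 (fun w : word => w ((s * t)%g p)) eq_w.
by rewrite /= !ffunE permK permM permK.
Qed.

(** The Gram matrix commutes with the group and maps every function into the span
    of the polytabloids. *)
Definition gram w w' := \sum_t poly_word t w * poly_word t w'.

Lemma gram_content w w' : gram w w' != 0 -> has_content w'.
Proof.
move=> nz; apply: contrapT => ncw; case/eqP: nz; apply: big1 => t _.
by have [->|/poly_word_content//] := eqVneq (poly_word t w') 0; rewrite mulr0.
Qed.

Lemma gramC w w' : gram w w' = gram w' w.
Proof. by apply: eq_bigr => t _; rewrite mulrC. Qed.

Lemma gram_act g w w' : gram (word_act w g) (word_act w' g) = gram w w'.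
Proof.
by rewrite /gram (reindex_inj (mulIg g)); apply: eq_bigr => t _; rewrite !poly_word_act.
Qed.

(** The scalar by which the Gram operator acts on polytabloids does not vanish
    because a nontrivial sum of squares of integers does not. *)
Lemma gram_scalar : exists2 k : F, k != 0 &
  forall t w', \sum_w poly_word t w * gram w w' = k * poly_word t w'.
Proof.
have [k kE] := equivariant_poly_word gram_act gram_content.
(* The square norm of the image of a polytabloid is a sum over [t] of squares of the
   integers [dot t], and [dot 1 > 0]. *)
exists k => //; pose pz t w : int :=
  \sum_(s in col_stab N la) (-1) ^+ odd_perm s * (tableau_word (s * t)%g == w)%:R.
have pzE t w : poly_word t w = (pz t w)%:~R.
  rewrite rmorph_sum; apply: eq_bigr => s _.
  by rewrite rmorphM rmorph_sign rmorph_nat.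
pose dot t : int := \sum_w pz 1%g w * pz t w.
have sqE (z : int) : (z%:~R : F) * z%:~R = (`|z| ^ 2)%N%:R.
  have zzE : z * z = (`|z| * `|z|)%N%:Z.
    by rewrite PoszM !abszE -normrM ger0_norm // -expr2 sqr_ge0.
  by rewrite -intrM zzE -mulnn.
suff : (\sum_t `|dot t| ^ 2)%N%:R != 0 :> F.
  apply: contraNneq => k0; apply/eqP; rewrite natr_sum.
  transitivity (\sum_w' (\sum_w poly_word 1%g w * gram w w') * poly_word 1%g w'); last first.
    by rewrite big1 // => w' _; rewrite kE k0 !mul0r.
  transitivity (\sum_t \sum_w \sum_w'
      poly_word 1%g w * poly_word t w * (poly_word 1%g w' * poly_word t w')).
    apply: eq_bigr => t _; rewrite -sqE rmorph_sum mulr_suml; apply: eq_bigr => w _.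
    rewrite mulr_sumr; apply: eq_bigr => w' _.
    by rewrite !rmorphM /= -!pzE.
  under eq_bigr do rewrite exchange_big; rewrite exchange_big.
  apply: eq_bigr => w' _; rewrite exchange_big mulr_suml; apply: eq_bigr => w _ /=.
  by rewrite /gram mulr_sumr mulr_suml; apply: eq_bigr => t _; ring.
rewrite natr_char0_neq0 // -lt0n (bigD1 1%g) //= addn_gt0; apply/orP; left.
rewrite expn_gt0 absz_gt0 orbF.
rewrite psumr_neq0 => [|w _]; last by rewrite -expr2 sqr_ge0.
apply/hasP; exists (tableau_word 1%g); first by rewrite mem_index_enum.
rewrite -expr2 lt0r sqr_ge0 andbT sqrf_eq0.
by apply/eqP => pz0; have /eqP := poly_word_diag 1%g; rewrite pzE pz0 eq_sym oner_eq0.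
Qed.

Lemma highest_sum (I : Type) (e : seq I) (c : I -> F) (t : I -> 'S_N) :
  highest (fun w => \sum_(a <- e) c a * poly_word (t a) w).
Proof.
elim: e => [|a e IH].
  split=> [w|i j _ w]; first by rewrite big_nil eqxx.
  by rewrite /raise big1 // => p _; rewrite big_nil.
have := highest_linear (c a) (highest_poly_word (t a)) IH.
by congr highest; apply/funext=> w; rewrite big_cons.
Qed.

Section Projection.
Variable k : F.
Hypothesis k_neq0 : k != 0.
Hypothesis gramE : forall t w', \sum_w poly_word t w * gram w w' = k * poly_word t w'.

Definition specht_proj w w' := k^-1 * gram w w'.

Lemma poly_word_proj t w' : \sum_w poly_word t w * specht_proj w w' = poly_word t w'.
Proof.
rewrite -[RHS](mulKf k_neq0) -gramE mulr_sumr; apply: eq_bigr => w _.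
by rewrite mulrCA.
Qed.

Lemma specht_projC w w' : specht_proj w w' = specht_proj w' w.
Proof. by rewrite /specht_proj gramC. Qed.

Lemma specht_proj_act g w w' :
  specht_proj (word_act w g) (word_act w' g) = specht_proj w w'.
Proof. by rewrite /specht_proj gram_act. Qed.

Lemma specht_proj_content w w' : specht_proj w w' != 0 -> has_content w'.
Proof. by move=> nz; apply: (@gram_content w); apply: contraNneq nz => h; rewrite /specht_proj h mulr0. Qed.

Lemma specht_projE w w' :
  specht_proj w w' = \sum_t (k^-1 * poly_word t w) * poly_word t w'.
Proof. by rewrite /specht_proj mulr_sumr; apply: eq_bigr => t _; rewrite mulrA. Qed.

Lemma highest_proj v : highest v <-> forall w', \sum_w v w * specht_proj w w' = v w'.
Proof.
split=> [/highest_span[c vE] w' | fixv].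
  under eq_bigr do rewrite vE mulr_suml.
  rewrite exchange_big vE; apply: eq_bigr => t _.
  by rewrite -[in RHS]poly_word_proj mulr_sumr; apply: eq_bigr => w _; rewrite mulrA.
suff -> : v = fun w' => \sum_t (\sum_w v w * (k^-1 * poly_word t w)) * poly_word t w'.
  exact: highest_sum.
apply/funext=> w'; rewrite -fixv; under eq_bigr do rewrite specht_projE mulr_sumr.
rewrite exchange_big; apply: eq_bigr => t _; rewrite mulr_suml.
by apply: eq_bigr => w _; rewrite mulrA.
Qed.

Lemma specht_proj_idem x z : \sum_y specht_proj x y * specht_proj y z = specht_proj x z.
Proof.
move: z; apply/highest_proj; have := highest_sum (index_enum _)
  (fun t => k^-1 * poly_word t x) id.
by congr highest; apply/funext=> w; rewrite specht_projE.
Qed.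

(** The tabloid encoded by [w], as a set of tableaux; it is empty unless [w] has
    content [la], and only then does it determine [w]. *)
Definition tabloid_of w : {set 'S_N} := [set t | tableau_word t == w].

Lemma tabloid_of_act w g : tabloid_of (word_act w g) = (tabloid_of w :* g)%g.
Proof.
apply/setP=> t; rewrite mem_rcoset !inE -[RHS](inj_eq (@word_act_inj g)).
by rewrite tableau_word_act mulgKV.
Qed.

Lemma tabloid_of_inj w w' : has_content w -> tabloid_of w = tabloid_of w' -> w = w'.
Proof.
case/content_tableau=> t [word_t _] /setP/(_ t).
by rewrite !inE word_t eqxx => /esym/eqP.
Qed.

Lemma tabloidE t : tabloid la t = tabloid_of (tableau_word t).
Proof.
apply/setP=> t'; rewrite /tabloid mem_rcoset !inE; apply/forallP/eqP => [eq_row | eq_w p].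
  apply/ffunP=> x; rewrite !ffunE; apply/val_inj/esym/eqP => /=.
  by have := eq_row ((t'^-1)%g x); rewrite permM permKV.
have := congr1 (fun w : word => val (w (t' p))) eq_w; rewrite !ffunE permK /= permM.
by move=> ->.
Qed.

Definition tabloid_row w : 'rV[F]_#|{set 'S_N}| := delta_mx 0 (enum_rank (tabloid_of w)).

(** The kernel [specht_proj] transported to the permutation module on sets of
    tableaux. *)
Definition specht_proj_mx : 'M[F]_#|{set 'S_N}| :=
  \sum_w (tabloid_row w)^T *m \sum_w' specht_proj w w' *: tabloid_row w'.

Lemma polytabloidE t : polytabloid F la t = \sum_w poly_word t w *: tabloid_row w.
Proof.
under eq_bigr do rewrite scaler_suml.
rewrite exchange_big; apply: eq_bigr => s _.
rewrite (bigD1 (tableau_word (s * t)%g)) //= eqxx mulr1 /tabloid_vec tabloidE.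
by rewrite big1 ?addr0 // => w /negPf ne_w; rewrite eq_sym ne_w mulr0 scale0r.
Qed.

Lemma tabloid_row_tr w w' : has_content w ->
  tabloid_row w *m (tabloid_row w')^T = (w == w')%:R%:M.
Proof.
move=> cw; rewrite trmx_delta mul_delta_mx_cond (inj_eq enum_rank_inj).
have -> : (tabloid_of w == tabloid_of w') = (w == w').
  by apply/eqP/eqP => [/(tabloid_of_inj cw)|->].
by apply/matrixP=> i j; rewrite !ord1; case: eqP => _; rewrite !mxE ?eqxx ?mul0rn.
Qed.

Lemma polytabloid_proj t : polytabloid F la t *m specht_proj_mx = polytabloid F la t.
Proof.
rewrite polytabloidE mulmx_suml.
transitivity (\sum_w poly_word t w *: \sum_w' specht_proj w w' *: tabloid_row w').
  apply: eq_bigr => w _; have [->|/poly_word_content cw] := eqVneq (poly_word t w) 0.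
    by rewrite !scale0r mul0mx.
  rewrite -scalemxAl; congr (_ *: _); rewrite mulmx_sumr (bigD1 w) //=.
  rewrite mulmxA tabloid_row_tr // eqxx mul1mx [X in _ + X]big1 ?addr0 // => w' ne_w'.
  by rewrite mulmxA tabloid_row_tr // eq_sym (negPf ne_w') mul_scalar_mx scale0r.
under eq_bigr do rewrite scaler_sumr.
rewrite exchange_big; apply: eq_bigr => w' _; rewrite -poly_word_proj scaler_suml.
by apply: eq_bigr => w _; rewrite scalerA.
Qed.

Lemma specht_proj_sub : (specht_proj_mx <= specht_mx F N la)%MS.
Proof.
apply: summx_sub => w _; apply: mulmx_sub.
under eq_bigr do rewrite specht_projE scaler_suml.
rewrite exchange_big; apply: summx_sub => t _.
rewrite (eq_bigr (fun w' => (k^-1 * poly_word t w) *: (poly_word t w' *: tabloid_row w'))).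
  by rewrite -scaler_sumr -polytabloidE scalemx_sub // (sumsmx_sup t) // genmxE.
by move=> w' _; rewrite scalerA.
Qed.

Lemma specht_mx_proj : specht_mx F N la *m specht_proj_mx = specht_mx F N la.
Proof.
have [c ->] : exists c, specht_mx F N la
    = c *m \sum_t (delta_mx (enum_rank t) 0 : 'cV_#|'S_N|) *m polytabloid F la t.
  apply/submxP/sumsmx_subP=> t _; rewrite genmxE.
  have -> : polytabloid F la t = (delta_mx 0 (enum_rank t) : 'rV_#|'S_N|)
      *m \sum_t' (delta_mx (enum_rank t') 0 : 'cV_#|'S_N|) *m polytabloid F la t'.
    rewrite mulmx_sumr (bigD1 t) //= big1 => [|t' ne_t].
      by rewrite mulmxA mul_delta_mx addr0 [delta_mx _ _](_ : _ = 1%:M) ?mul1mx //;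
        apply/matrixP=> i j; rewrite !ord1 !mxE !eqxx.
    rewrite mulmxA mul_delta_mx_cond (inj_eq enum_rank_inj) eq_sym (negPf ne_t).
    by rewrite mulr0n mul0mx.
  exact: submxMl.
rewrite -mulmxA mulmx_suml; congr (_ *m _); apply: eq_bigr => t _.
by rewrite -mulmxA polytabloid_proj.
Qed.

Lemma specht_trace g :
  repr_tr (specht_repr F N la) g = \sum_w specht_proj (word_act w g) w.
Proof.
rewrite /repr_tr (mxtrace_submod _ _ specht_proj_sub) ?inE ?specht_mx_proj //.
rewrite mulmx_sumr linear_sum /=.
transitivity (\sum_w \sum_w' specht_proj w w' * (w == word_act w' g)%:R); last first.
  rewrite exchange_big; apply: eq_bigr => w' _.
  rewrite (bigD1 (word_act w' g)) //= eqxx mulr1 big1 ?addr0 // => w /negPf->.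
  by rewrite mulr0.
apply: eq_bigr => w _; rewrite mulmxA mulmx_sumr linear_sum /=.
apply: eq_bigr => w' _; rewrite -scalemxAr linearZ /=.
have [->|nz] := eqVneq (specht_proj w w') 0; first by rewrite !mul0r.
have cw : has_content w by apply: (@specht_proj_content w'); rewrite specht_projC.
congr (_ * _); rewrite mxtrace_mulC mulmxA delta_perm_repr.
rewrite /= rcosetE -tabloid_of_act -/(tabloid_row _) -[X in \tr X]trmxK trmx_mul trmxK.
by rewrite tabloid_row_tr // tr_scalar_mx mxtrace_scalar.
Qed.

(** The projection is symmetric and permutation matrices are orthogonal. *)
Lemma specht_traceV g :
  repr_tr (specht_repr F N la) g^-1%g = repr_tr (specht_repr F N la) g.
Proof.
rewrite !specht_trace [RHS](reindex_inj (@word_act_inj g^-1%g)).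
apply: eq_bigr => w _; rewrite specht_projC.
by rewrite -word_actM mulVg word_act1.
Qed.

(** The norm is the dimension of the space of invariant functions of two words that
    lie in the Specht module in both arguments.  Read as kernels, these are the
    equivariant operators of the Specht module, which are scalar. *)
Lemma specht_norm :
  pairing [set: 'S_N] (repr_tr (specht_repr F N la)) (repr_tr (specht_repr F N la)) = 1.
Proof.
pose act2 (x : word * word) g := (word_act x.1 g, word_act x.2 g).
pose K2 (x y : word * word) := specht_proj x.1 y.1 * specht_proj x.2 y.2.
have pair_sum (f : word -> word -> F) : \sum_(x : word * word) f x.1 x.2 = \sum_w \sum_w' f w w'.
  by rewrite pair_bigA.
have [||g x y|x z|d dimd trd] := has_dim_invariants charF0 (act := act2) (K := K2).
- by move=> [w w']; rewrite /act2 !word_act1.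
- by move=> [w w'] g h; rewrite /act2 /= !word_actM.
- by rewrite /K2 !specht_proj_act.
- rewrite (pair_sum (fun a b => K2 x (a, b) * K2 (a, b) z)) /K2 /=.
  rewrite -!specht_proj_idem mulr_suml; apply: eq_bigr => a _.
  by rewrite mulr_sumr; apply: eq_bigr => b _; rewrite mulrACA.
suff d1 : d = 1%N.
  rewrite -[RHS](_ : d%:R = 1) ?d1 // -d1 trd /pairing cardsT; congr (_ * _).
  apply: eq_big => [g|g _]; first by rewrite inE.
  rewrite specht_traceV specht_trace (pair_sum (fun a b => K2 (act2 (a, b) g) (a, b))).
  by rewrite mulr_suml; apply: eq_bigr => a _; rewrite mulr_sumr.
apply: (has_dim_uniq dimd); exists (fun u x => u 0 0 * specht_proj x.1 x.2).
split=> [a u u' x|u u0|v].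
- by rewrite /= !mxE; ring.
- apply/rowP=> i; rewrite !ord1 mxE; apply/eqP; apply: contraT => nz.
  have := poly_word_proj 1%g (tableau_word 1%g); rewrite poly_word_diag.
  rewrite big1 => [/esym/eqP|w _]; first by rewrite oner_eq0.
  by have /eqP := u0 (w, tableau_word 1%g); rewrite mulf_eq0 (negPf nz) => /eqP ->; rewrite mulr0.
split=> [[inv_v fixv]|[u vE]]; last first.
  split=> [g x|y]; first by rewrite !vE specht_proj_act.
  under eq_bigr do rewrite vE -mulrA.
  rewrite -mulr_sumr vE; congr (_ * _).
  rewrite (pair_sum (fun a b => specht_proj a b * K2 (a, b) y)) /K2 /=.
  rewrite -specht_proj_idem; apply: eq_bigr => a _.
  under eq_bigr do rewrite mulrCA.
  by rewrite -mulr_sumr specht_proj_idem -specht_projC mulrC specht_projC.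
pose T w w' := v (w, w').
have vE y y' : T y y' = \sum_a \sum_b T a b * (specht_proj a y * specht_proj b y').
  rewrite /T -fixv -(pair_sum (fun a b => v (a, b) * K2 (a, b) (y, y'))).
  by apply: eq_bigr => -[a b].
have T_content w w' : T w w' != 0 -> has_content w'.
  move=> nz; apply: contrapT => ncw; case/eqP: nz; rewrite vE.
  rewrite big1 // => a _; rewrite big1 // => b _.
  have [->|/specht_proj_content//] := eqVneq (specht_proj b w') 0.
  by rewrite !mulr0.
have [c cE] := equivariant_poly_word (fun g w w' => inv_v g (w, w')) T_content.
exists (const_mx c) => -[y y'] /=; rewrite mxE -/(T y y').
transitivity (\sum_z specht_proj y z * T z y').
  under [RHS]eq_bigr do rewrite vE mulr_sumr.
  rewrite exchange_big vE; apply: eq_bigr => a _.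
  under [RHS]eq_bigr do rewrite mulr_sumr.
  rewrite exchange_big; apply: eq_bigr => b _ /=.
  rewrite -[specht_proj a y]specht_proj_idem mulr_suml mulr_sumr.
  by apply: eq_bigr => z _; rewrite (specht_projC z y); ring.
under eq_bigr do rewrite specht_projE mulr_suml.
rewrite exchange_big specht_projE mulr_sumr; apply: eq_bigr => t _.
under eq_bigr do rewrite -mulrA.
by rewrite -mulr_sumr cE mulrCA.
Qed.

End Projection.

(** The two descriptions of the Specht module needed at the same time: as the image
    of an equivariant idempotent, for traces, and by the raising operators, which are
    compatible with a change of [N]. *)
Lemma specht_kernel : exists K : word -> word -> F,
  [/\ forall g w w', K (word_act w g) (word_act w' g) = K w w',
      forall x z, \sum_y K x y * K y z = K x z,
      forall v, highest v <-> (forall w', \sum_w v w * K w w' = v w')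
    & forall g, repr_tr (specht_repr F N la) g = \sum_w K (word_act w g) w].
Proof.
have [k nzk kE] := gram_scalar; exists (specht_proj k).
by split; [apply: specht_proj_act | apply: specht_proj_idem nzk kE
  | apply: highest_proj nzk kE | apply: specht_trace nzk kE].
Qed.

Lemma specht_trV g :
  repr_tr (specht_repr F N la) g^-1%g = repr_tr (specht_repr F N la) g.
Proof. by have [k nzk kE] := gram_scalar; apply: specht_traceV nzk kE g. Qed.

Lemma specht_pairing :
  pairing [set: 'S_N] (repr_tr (specht_repr F N la)) (repr_tr (specht_repr F N la)) = 1.
Proof. by have [k nzk kE] := gram_scalar; apply: specht_norm nzk kE. Qed.

End Tableaux.

(** * Multiplication by a letter in the symmetric algebra *)

Section LetterInsertion.
Variables (F : fieldType) (Y : eqType) (Z : Type) (x0 : Y).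
Hypothesis charF0 : [pchar F] =i pred0.

Definition permute n (y : {ffun 'I_n -> Y}) (s : 'S_n) : {ffun 'I_n -> Y} :=
  [ffun i => y (s i)].

Definition delete n (q : 'I_n.+1) (y : {ffun 'I_n.+1 -> Y}) : {ffun 'I_n -> Y} :=
  [ffun i => y (lift q i)].

Definition insert n (y : {ffun 'I_n -> Y}) : {ffun 'I_n.+1 -> Y} :=
  [ffun i => oapp y x0 (unlift ord0 i)].

Definition symmetric n (T : {ffun 'I_n -> Y} * Z -> F) :=
  forall s y z, T (permute y s, z) = T (y, z).

Definition mult_x0 n (y : {ffun 'I_n -> Y}) := #|[pred q | y q == x0]|.

(** A symmetric function of words of length [n] is an element of the [n]-th
    symmetric power of the space with basis [Y]; this is multiplication by [x0]. *)
Definition mul_x0 n (T : {ffun 'I_n -> Y} * Z -> F) (yz : {ffun 'I_n.+1 -> Y} * Z) : F :=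
  \sum_(q | yz.1 q == x0) T (delete q yz.1, yz.2).

(** Up to a permutation of the remaining positions, only the deleted letter matters,
    and symmetric functions ignore that permutation. *)
Lemma delete_permute n (y : {ffun 'I_n.+1 -> Y}) (s : 'S_n.+1) q :
  exists s', delete q (permute y s) = permute (delete (s q) y) s'.
Proof.
have /choice[f fP] i : exists j, s (lift q i) = lift (s q) j.
  have := neq_lift q i; rewrite -(inj_eq (@perm_inj _ s)) => /unlift_some[j -> _].
  by exists j.
have f_inj : injective f.
  move=> i i' eq_f; apply: (@lift_inj _ q); apply: (@perm_inj _ s).
  by rewrite !fP eq_f.
by exists (perm f_inj); apply/ffunP=> i; rewrite !ffunE permE fP.
Qed.

Lemma insert_delete n (y : {ffun 'I_n.+1 -> Y}) q : y q = x0 ->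
  insert (delete q y) = permute y (lift_perm ord0 q 1%g).
Proof.
move=> yq; apply/ffunP=> i; rewrite !ffunE.
case: unliftP => [j ->|->] /=; first by rewrite ffunE lift_perm_lift perm1.
by rewrite lift_perm_id yq.
Qed.

Lemma delete_insert n (y : {ffun 'I_n -> Y}) : delete ord0 (insert y) = y.
Proof. by apply/ffunP=> i; rewrite !ffunE liftK. Qed.

Lemma insert0 n (y : {ffun 'I_n -> Y}) : insert y ord0 = x0.
Proof. by rewrite ffunE unlift_none. Qed.

Lemma insert_permute n (y : {ffun 'I_n -> Y}) s :
  insert (permute y s) = permute (insert y) (lift_perm ord0 ord0 s).
Proof.
apply/ffunP=> i; rewrite !ffunE; case: unliftP => [j ->|->] /=.
  by rewrite lift_perm_lift liftK /= ffunE.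
by rewrite lift_perm_id unlift_none.
Qed.

Lemma mult_permute n (y : {ffun 'I_n -> Y}) s : mult_x0 (permute y s) = mult_x0 y.
Proof.
rewrite /mult_x0 -!sum1_card [RHS](reindex_inj (@perm_inj _ s)).
by apply: eq_bigl => q; rewrite !inE ffunE.
Qed.

Lemma symmetric_delete n (T : {ffun 'I_n -> Y} * Z -> F) (y : {ffun 'I_n.+1 -> Y}) z q q' :
    symmetric T ->
  y q = x0 -> y q' = x0 -> T (delete q y, z) = T (delete q' y, z).
Proof.
move=> symT yq yq'; have [s] := delete_permute y (tperm q' q) q'.
have -> : permute y (tperm q' q) = y.
  by apply/ffunP=> i; rewrite ffunE; case: tpermP => [->|->|]; rewrite ?yq ?yq'.
by rewrite tpermL => ->; rewrite symT.
Qed.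

Lemma mul_x0_symmetric n (T : {ffun 'I_n -> Y} * Z -> F) :
  symmetric T -> symmetric (mul_x0 T).
Proof.
move=> symT s y z; rewrite /mul_x0 /= [RHS](reindex_inj (@perm_inj _ s)) /=.
apply: eq_big => [q|q _]; first by rewrite ffunE.
by have [s' ->] := delete_permute y s q; rewrite symT.
Qed.

(** The value of the product on [insert y] is the value on [y] times the number of
    occurrences of [x0], which is positive. *)
Lemma mul_x0_inj n (T : {ffun 'I_n -> Y} * Z -> F) : symmetric T ->
  (forall yz, mul_x0 T yz = 0) -> forall yz, T yz = 0.
Proof.
move=> symT T0 [y z]; have := T0 (insert y, z); rewrite /mul_x0 /=.
rewrite (eq_bigr (fun=> T (y, z))) => [|q /eqP yq]; last first.
  by rewrite (symmetric_delete z symT yq (insert0 y)) delete_insert.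
rewrite sumr_const -mulr_natr => /eqP; rewrite mulf_eq0 => /orP[/eqP//|].
rewrite -[_ == 0]negbK natr_char0_neq0 // -lt0n => /negP; case.
by apply/card_gt0P; exists ord0; apply/eqP/insert0.
Qed.

(** The inverse of [mul_x0] on the functions supported on the words containing [x0]. *)
Definition div_x0 n (T : {ffun 'I_n.+1 -> Y} * Z -> F) (yz : {ffun 'I_n -> Y} * Z) : F :=
  (mult_x0 (insert yz.1))%:R^-1 * T (insert yz.1, yz.2).

Lemma div_x0_symmetric n (T : {ffun 'I_n.+1 -> Y} * Z -> F) :
  symmetric T -> symmetric (div_x0 T).
Proof. by move=> symT s y z; rewrite /div_x0 /= insert_permute mult_permute symT. Qed.

Lemma div_x0K n (T : {ffun 'I_n.+1 -> Y} * Z -> F) : symmetric T ->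
    (forall y z, T (y, z) != 0 -> exists q, y q = x0) ->
  T =1 mul_x0 (div_x0 T).
Proof.
move=> symT suppT [y z]; rewrite /mul_x0 /=.
rewrite (eq_bigr (fun=> (mult_x0 y)%:R^-1 * T (y, z))) => [|q /eqP yq]; last first.
  by rewrite /div_x0 /= insert_delete // mult_permute symT.
have [->|/suppT[q yq]] := eqVneq (T (y, z)) 0; first by rewrite mulr0 big1.
rewrite sumr_const -/(mult_x0 y) -[_ *+ _]mulr_natl mulVKf // natr_char0_neq0 // -lt0n.
by apply/card_gt0P; exists q; apply/eqP.
Qed.

End LetterInsertion.

Section Derivations.
Variables (F : fieldType) (Y : finType) (Z : Type) (x0 : Y).
Hypothesis charF0 : [pchar F] =i pred0.

Definition put n (y : {ffun 'I_n -> Y}) (p : 'I_n) (u : Y) : {ffun 'I_n -> Y} :=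
  [ffun i => if i == p then u else y i].

(** The derivation of the symmetric algebra extending the linear map with
    matrix [c] on letters. *)
Definition derivation (c : Y -> Y -> F) n (T : {ffun 'I_n -> Y} * Z -> F)
    (yz : {ffun 'I_n -> Y} * Z) : F :=
  \sum_p \sum_u c (yz.1 p) u * T (put yz.1 p u, yz.2).

Lemma derivation_symmetric c n (T : {ffun 'I_n -> Y} * Z -> F) :
  symmetric T -> symmetric (derivation c T).
Proof.
move=> symT s y z; rewrite /derivation /= [RHS](reindex_inj (@perm_inj _ s)) /=.
apply: eq_bigr => p _; apply: eq_bigr => u _; rewrite ffunE; congr (_ * _).
rewrite -[RHS](symT s); congr (T (_, _)); apply/ffunP=> i; rewrite !ffunE.
by rewrite (inj_eq perm_inj).
Qed.

(** Leibniz rule: the derivation of [x0] itself vanishes, since [c] has no entry in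
    its column. *)
Lemma derivation_mul_x0 c n (T : {ffun 'I_n -> Y} * Z -> F) : (forall u, c u x0 = 0) ->
  derivation c (mul_x0 x0 T) =1 mul_x0 x0 (derivation c T).
Proof.
move=> c_x0 [y z]; rewrite /derivation /mul_x0 /=.
transitivity (\sum_q \sum_(p | p != q) \sum_u
    (y q == x0)%:R * (c (y p) u * T (delete q (put y p u), z))).
  rewrite [RHS](exchange_big_dep xpredT) //=; apply: eq_bigr => p _.
  rewrite [RHS]exchange_big; apply: eq_bigr => u _; rewrite mulr_sumr.
  rewrite big_mkcond [RHS]big_mkcond; apply: eq_bigr => q _.
  rewrite ffunE [q == p]eq_sym; have [->|ne_pq] := eqVneq p q.
    by case: eqP => // ->; rewrite c_x0 mul0r.
  by case: eqP => _; rewrite ?mul1r ?mul0r.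
rewrite [RHS]big_mkcond; apply: eq_bigr => q _ /=.
case: (y q == x0); last by rewrite big1 // => p _; rewrite big1 // => u _; rewrite mul0r.
rewrite big_mkcond (bigD1_ord q) //= eqxx add0r; apply: eq_bigr => p _.
rewrite eq_sym neq_lift.
apply: eq_bigr => u _; rewrite mul1r ffunE; congr (_ * T (_, _)).
by apply/ffunP=> i; rewrite !ffunE (inj_eq lift_inj).
Qed.

End Derivations.

Section Stability.
Variables (F : fieldType) (Y : finType) (Z : Type) (x0 : Y).
Hypothesis charF0 : [pchar F] =i pred0.
Variables (C A : Type) (kernel : C -> Y -> Y -> F).
Variables (letter_act : A -> Y -> Y) (param_act : A -> Z -> Z).
Variable param_space : (Z -> F) -> Prop.

Hypothesis kernel_x0 : forall c u, kernel c u x0 = 0.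
Hypothesis letter_act_x0 : forall a u, (letter_act a u == x0) = (u == x0).
Hypothesis param_space0 : param_space (fun=> 0).
Hypothesis param_space_linear : forall a u v, param_space u -> param_space v ->
  param_space (fun z => a * u z + v z).

Definition map_word n (f : Y -> Y) (y : {ffun 'I_n -> Y}) : {ffun 'I_n -> Y} :=
  [ffun i => f (y i)].

(** The parameter in [Z] stands for the word [x2], which does not change with [n];
    [param_space] is the condition on it. *)
Definition stable_space n (weight : {ffun 'I_n -> Y} -> Prop)
    (T : {ffun 'I_n -> Y} * Z -> F) :=
  [/\ symmetric T,
      forall a y z, T (map_word (letter_act a) y, param_act a z) = T (y, z),
      forall c yz, derivation (kernel c) T yz = 0,
      forall y z, T (y, z) != 0 -> weight y
    & forall y, param_space (fun z => T (y, z))].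

(** Multiplication by [x0] is a bijection between the two spaces, with inverse
    [div_x0]. *)
Lemma stable_dim n (weight : {ffun 'I_n -> Y} -> Prop)
    (weight' : {ffun 'I_n.+1 -> Y} -> Prop) d :
    (forall (y : {ffun 'I_n.+1 -> Y}) q, y q = x0 -> (weight' y <-> weight (delete q y))) ->
    (forall y : {ffun 'I_n.+1 -> Y}, weight' y -> exists q, y q = x0) ->
  has_dim (stable_space weight) d -> has_dim (stable_space weight') d.
Proof.
move=> weight_delete weight_x0; apply: (has_dim_iso (phi := @mul_x0 F Y Z x0 n)).
- move=> a u v yz; rewrite /mul_x0 mulr_sumr -big_split.
  exact: eq_bigr.
- move=> T [symT actT derT wtT parT]; split.
  + exact: mul_x0_symmetric.
  + move=> a y z; rewrite /mul_x0 /=; apply: eq_big => [q|q _].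
      by rewrite ffunE letter_act_x0.
    rewrite -[RHS](actT a); congr (T (_, _)).
    by apply/ffunP=> i; rewrite !ffunE.
  + by move=> c yz; rewrite derivation_mul_x0 // /mul_x0 big1.
  + move=> y z nz; apply: contrapT => nwt; case/eqP: nz; apply: big1 => q /eqP yq.
    apply/eqP; apply: contraT => /wtT wt; case: nwt.
    exact/(weight_delete _ _ yq).
  + move=> y; rewrite /mul_x0 /=; elim: index_enum => [|q e IH].
      have := param_space0; congr param_space.
      by apply/funext=> z; rewrite big_nil.
    have := param_space_linear (y q == x0)%:R (parT (delete q y)) IH.
    congr param_space; apply/funext=> z; rewrite big_cons.
    by case: (y q == x0); rewrite ?mul1r // mul0r add0r.
- by move=> T [symT _ _ _ _]; apply: mul_x0_inj.
move=> T' [symT actT derT wtT parT]; have T'E : T' =1 mul_x0 x0 (div_x0 x0 T').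
  by apply: div_x0K => // y z /wtT/weight_x0.
have symD := div_x0_symmetric x0 symT.
exists (div_x0 x0 T') => //; split=> //.
- move=> a y z; rewrite /div_x0 /= -(actT a (insert _ y)).
  have <- : insert x0 (map_word (letter_act a) y) = map_word (letter_act a) (insert x0 y).
    apply/ffunP=> i; rewrite !ffunE; case: unliftP => [j _|_] /=; first by rewrite ffunE.
    by apply/esym/eqP; rewrite letter_act_x0.
  congr (_%:R^-1 * _); apply: eq_card => q; rewrite !inE !ffunE.
  by case: unliftP => [j _|_] //=; rewrite ffunE letter_act_x0.
(* The quotient is killed by the derivations because its product with [x0] is. *)
- move=> c; apply: (mul_x0_inj charF0 (x0 := x0)); first exact: derivation_symmetric.
  by move=> yz; rewrite -derivation_mul_x0 // -(funext T'E).
- move=> y z; rewrite /div_x0 /= mulf_eq0 negb_or => /andP[_ /wtT].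
  by move/(weight_delete _ _ (insert0 x0 y)); rewrite delete_insert.
move=> y; have := param_space_linear (mult_x0 x0 (insert x0 y))%:R^-1 (parT (insert x0 y)) param_space0.
by congr param_space; apply/funext=> z; rewrite addr0.
Qed.

End Stability.

(** * Multiplicities as dimensions of spaces of invariants *)

(** The image of a tensor product of projections is described slice by slice, because
    each factor fixes what the product fixes. *)
Lemma fixed_prod (F : fieldType) (A B : finType) (KA : A -> A -> F) (KB : B -> B -> F)
    (v : A * B -> F) :
    (forall x z, \sum_y KA x y * KA y z = KA x z) ->
    (forall x z, \sum_y KB x y * KB y z = KB x z) ->
  (forall y, \sum_x v x * (KA x.1 y.1 * KB x.2 y.2) = v y) <->
  (forall b a', \sum_a v (a, b) * KA a a' = v (a', b))
  /\ (forall a b', \sum_b v (a, b) * KB b b' = v (a, b')).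
Proof.
move=> idemA idemB; pose w a b := v (a, b).
have sumE y : \sum_x v x * (KA x.1 y.1 * KB x.2 y.2)
    = \sum_a \sum_b w a b * (KA a y.1 * KB b y.2).
  by rewrite pair_bigA; apply: eq_bigr => -[a b].
split=> [fixv|[fixA fixB] [a' b']].
  have wE a b : w a b = \sum_a0 \sum_b0 w a0 b0 * (KA a0 a * KB b0 b).
    by rewrite -(sumE (a, b)) fixv.
  split=> [b a'|a b'].
    under eq_bigr do rewrite -/(w _ _) wE mulr_suml.
    rewrite -/(w _ _) wE exchange_big; apply: eq_bigr => a0 _ /=.
    under eq_bigr do rewrite mulr_suml.
    rewrite exchange_big; apply: eq_bigr => b0 _ /=.
    rewrite -[KA a0 a']idemA mulr_suml mulr_sumr; apply: eq_bigr => a _; ring.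
  under eq_bigr do rewrite -/(w _ _) wE mulr_suml.
  rewrite -/(w _ _) wE exchange_big; apply: eq_bigr => a0 _ /=.
  under eq_bigr do rewrite mulr_suml.
  rewrite exchange_big; apply: eq_bigr => b0 _ /=.
  rewrite -[KB b0 b']idemB !mulr_sumr; apply: eq_bigr => b _; ring.
rewrite sumE /= -fixB; under [RHS]eq_bigr do rewrite -fixA mulr_suml.
rewrite exchange_big; apply: eq_bigr => b _; apply: eq_bigr => a _.
by rewrite mulrA.
Qed.

Lemma embed_invE k l (g : 'S_k * 'S_l) i j :
  ((embed g)^-1)%g (mxvec_index i j) = mxvec_index ((g.1^-1)%g i) ((g.2^-1)%g j).
Proof.
by apply: (@perm_inj _ (embed g)); rewrite permKV permE /embed_fun mxvec_indexK !permKV.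
Qed.

(** The invariants in the tensor product of the Specht modules of [la], [mu], [nu]. *)
Definition multiplicity_space (F : fieldType) n l (la mu nu : seq nat) q s t
    (T : {ffun 'I_n -> 'I_q} * {ffun 'I_l -> 'I_s} * {ffun 'I_(n * l) -> 'I_t} -> F) :=
  [/\ forall (g : 'S_n * 'S_l) x1 x2 x3,
        T (word_act x1 g.1, word_act x2 g.2, word_act x3 (embed g)) = T (x1, x2, x3),
      forall x2 x3, highest la (fun x1 => T (x1, x2, x3)),
      forall x1 x3, highest mu (fun x2 => T (x1, x2, x3))
    & forall x1 x2, highest nu (fun x3 => T (x1, x2, x3))].

Section MultiplicitySpace.
Variables (F : closedFieldType) (n l : nat) (la mu nu : seq nat) (q s t : nat).
Hypothesis charF0 : [pchar F] =i pred0.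

Hypotheses (la_part : is_partition n la) (mu_part : is_partition l mu).
Hypothesis nu_part : is_partition (n * l) nu.
Hypotheses (le_la : (size la <= q)%N) (le_mu : (size mu <= s)%N).
Hypothesis le_nu : (size nu <= t)%N.

Let chi N eta := repr_tr (specht_repr F N eta).

Lemma specht_tensor_trace (g : 'S_n * 'S_l) :
  repr_tr (specht_tensor F n l la mu) g = chi la g.1 * chi mu g.2.
Proof. exact: mxtrace_prod. Qed.

Lemma specht_tensor_irreducible : mx_irreducible (specht_tensor F n l la mu).
Proof.
apply: irreducible_of_pairing1 => //.
have := specht_pairing charF0 mu_part le_mu; have := specht_pairing charF0 la_part le_la.
rewrite /pairing => pair_la pair_mu.
have cardE : #|[set: 'S_n * 'S_l]|%:R = #|[set: 'S_n]|%:R * #|[set: 'S_l]|%:R :> F.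
  by rewrite -natrM !cardsT card_prod.
transitivity (1 * 1 : F); last exact: mulr1.
rewrite -[X in _ = X * _]pair_la -[X in _ = _ * X]pair_mu cardE invfM [RHS]mulrACA.
congr (_ * _).
rewrite mulr_suml; under [RHS]eq_bigr do rewrite mulr_sumr.
rewrite pair_big /=; apply: eq_big => [g|g _]; first by rewrite !inE.
by rewrite !specht_tensor_trace /= mulrACA.
Qed.

(** The multiplicity is the pairing of a product of two characters with a third; as
    characters of symmetric groups are unchanged by [g |-> g^-1], this is the mean of
    the product of the three, the trace of the projection onto the invariants. *)
Lemma b_coef_dim : has_dim (@multiplicity_space F n l la mu nu q s t) (b_coef F n l la mu nu).
Proof.
have [Ka [Ka_act Ka_idem Ka_fix Ka_tr]] := specht_kernel charF0 la_part le_la.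
have [Kb [Kb_act Kb_idem Kb_fix Kb_tr]] := specht_kernel charF0 mu_part le_mu.
have [Kc [Kc_act Kc_idem Kc_fix Kc_tr]] := specht_kernel charF0 nu_part le_nu.
set X := ({ffun 'I_n -> 'I_q} * {ffun 'I_l -> 'I_s} * {ffun 'I_(n * l) -> 'I_t})%type.
pose act (x : X) (g : 'S_n * 'S_l) : X :=
  (word_act x.1.1 g.1, word_act x.1.2 g.2, word_act x.2 (embed g)).
pose Kab (x y : {ffun 'I_n -> 'I_q} * {ffun 'I_l -> 'I_s}) := Ka x.1 y.1 * Kb x.2 y.2.
pose K (x y : X) := Kab x.1 y.1 * Kc x.2 y.2.
have sum_prod (A B : finType) (f : A -> F) (g : B -> F) :
    \sum_(x : A * B) f x.1 * g x.2 = (\sum_a f a) * (\sum_b g b).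
  by rewrite mulr_suml; under [RHS]eq_bigr do rewrite mulr_sumr; rewrite pair_bigA.
have Kab_idem x z : \sum_y Kab x y * Kab y z = Kab x z.
  under eq_bigr do rewrite mulrACA.
  by rewrite (sum_prod _ _ (fun a => Ka x.1 a * Ka a z.1) (fun b => Kb x.2 b * Kb b z.2))
    Ka_idem Kb_idem.
have [||g x y|x z|d dimd trd] := has_dim_invariants charF0 (act := act) (K := K).
- move=> [[x1 x2] x3]; rewrite /act /= !word_act1.
  have -> : embed (1%g : 'S_n * 'S_l) = 1%g by exact: (morph1 (embed_morphism n l)).
  by rewrite word_act1.
- move=> [[x1 x2] x3] g h; rewrite /act /= !word_actM embedM ?inE //.
  by rewrite word_actM.
- by rewrite /K /Kab /= Ka_act Kb_act Kc_act.
- under eq_bigr do rewrite mulrACA.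
  by rewrite (sum_prod _ _ (fun a => Kab x.1 a * Kab a z.1) (fun c => Kc x.2 c * Kc c z.2))
    Kab_idem Kc_idem.
have -> : b_coef F n l la mu nu = d.
  apply: (natr_char0_inj charF0); rewrite /b_coef repr_mult_pairing //; last first.
    exact: specht_tensor_irreducible.
  rewrite trd /pairing; congr (_ * _); apply: eq_big => [g|g _]; first by rewrite inE.
  rewrite specht_tensor_trace /chi /=.
  rewrite (specht_trV charF0 la_part le_la) (specht_trV charF0 mu_part le_mu).
  rewrite (sum_prod _ _ (fun x => Kab (word_act x.1 g.1, word_act x.2 g.2) x)
     (fun x3 => Kc (word_act x3 (embed g)) x3)).
  rewrite (sum_prod _ _ (fun x1 => Ka (word_act x1 g.1) x1)
     (fun x2 => Kb (word_act x2 g.2) x2)).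
  by rewrite Ka_tr Kb_tr -Kc_tr.
have [f [lin_f inj_f rng_f]] := dimd; exists f; split=> // T.
rewrite -rng_f (fixed_prod T Kab_idem Kc_idem).
split=> [[invT hla hmu hnu] | [invT [fixab fixc]]].
  split=> [g [[x1 x2] x3]|]; first exact: invT.
  split=> [x3 x12'|[x1 x2] x3']; last first.
    exact: ((Kc_fix _).1 (hnu x1 x2) x3').
  move: x12'; apply: (fixed_prod (fun x12 => T (x12, x3)) Ka_idem Kb_idem).2.
  split=> [x2 x1|x1 x2].
    exact: ((Ka_fix _).1 (hla x2 x3) x1).
  exact: ((Kb_fix _).1 (hmu x1 x3) x2).
have fixE x3 := (fixed_prod (fun x12 => T (x12, x3)) Ka_idem Kb_idem).1 (fixab x3).
split=> [g x1 x2 x3|x2 x3|x1 x3|x1 x2]; first exact: (invT g (x1, x2, x3)).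
- by apply/Ka_fix => x1; apply: (fixE x3).1.
- by apply/Kb_fix => x2'; apply: (fixE x3).2.
by apply/Kc_fix => x3; apply: fixc.
Qed.

End MultiplicitySpace.

(** * Words of labelled rows and the stability theorem *)

Section Rows.
Variables (F : fieldType) (l q t : nat).
Notation Y := ('I_q.+1 * {ffun 'I_l -> 'I_t.+1})%type.

Definition row_word n (y : {ffun 'I_n -> Y}) : {ffun 'I_n -> 'I_q.+1} :=
  [ffun i => (y i).1].

Definition matrix_word n (y : {ffun 'I_n -> Y}) : {ffun 'I_(n * l) -> 'I_t.+1} :=
  [ffun p => (y (cell_of p).1).2 (cell_of p).2].

Definition join_words n (x1 : {ffun 'I_n -> 'I_q.+1}) (x3 : {ffun 'I_(n * l) -> 'I_t.+1})
  : {ffun 'I_n -> Y} := [ffun i => (x1 i, [ffun m => x3 (mxvec_index i m)])].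

Lemma row_wordK n (x1 : {ffun 'I_n -> 'I_q.+1}) x3 : row_word (join_words x1 x3) = x1.
Proof. by apply/ffunP=> i; rewrite !ffunE. Qed.

Lemma matrix_wordK n (x1 : {ffun 'I_n -> 'I_q.+1}) x3 : matrix_word (join_words x1 x3) = x3.
Proof.
by apply/ffunP=> p; case/mxvec_indexP: p => i m; rewrite ffunE mxvec_indexK !ffunE.
Qed.

Lemma join_wordsK n (y : {ffun 'I_n -> Y}) : join_words (row_word y) (matrix_word y) = y.
Proof.
apply/ffunP=> i; rewrite !ffunE [RHS]surjective_pairing; congr (_, _).
by apply/ffunP=> m; rewrite !ffunE mxvec_indexK.
Qed.

Lemma sum_matrix (V : nmodType) n (f : 'I_(n * l) -> V) :
  \sum_p f p = \sum_i \sum_m f (mxvec_index i m).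
Proof.
by rewrite pair_bigA (reindex _ (curry_mxvec_bij _ _)); apply: eq_bigr => -[].
Qed.

(** The letter [x0]: the first coordinate is the label of the row, the second its
    entries. *)
Definition zero_letter : Y := (ord0, [ffun=> ord0]).

Definition column_act (a : 'S_l) (u : Y) : Y := (u.1, [ffun m => u.2 ((a^-1)%g m)]).

Lemma column_act_zero a u : (column_act a u == zero_letter) = (u == zero_letter).
Proof.
case: u => u1 u2; rewrite /column_act /zero_letter !xpair_eqE /=; congr (_ && _).
apply/eqP/eqP => [/ffunP eq0 | ->]; apply/ffunP=> m; rewrite !ffunE //.
by have := eq0 (a m); rewrite !ffunE permK.
Qed.

(** The matrices on letters of the raising operators of the two kinds. *)
Definition raising_kernel (c : 'I_q.+1 * 'I_q.+1 + 'I_t.+1 * 'I_t.+1) (u u' : Y) : F :=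
  match c with
  | inl (i, j) => ((i < j)%N && (u.1 == i) && (u' == (j, u.2)))%:R
  | inr (i, j) => \sum_m ((i < j)%N && (u.2 m == i) && (u' == (u.1, subst_letter u.2 m j)))%:R
  end.

(** A nonzero entry has a letter [j > i] in its target, whereas the letters of [x0] are
    all 0. *)
Lemma raising_kernel_zero c u : raising_kernel c u zero_letter = 0.
Proof.
case: c => -[i j] /=; last rewrite big1 // => m _.
  case: ltnP => //= lt_ij; case: eqP => //= _; rewrite xpair_eqE.
  by case: eqP => // j0; rewrite -j0 in lt_ij.
case: ltnP => //= lt_ij; case: eqP => //= _; rewrite xpair_eqE.
case: (_ == u.1) => //=; case: eqP => // /ffunP/(_ m); rewrite !ffunE eqxx => j0.
by rewrite -j0 in lt_ij.
Qed.

Section Translation.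
Variables (Z : Type) (n : nat) (T : {ffun 'I_n -> 'I_q.+1} * Z * {ffun 'I_(n * l) -> 'I_t.+1} -> F).
Definition on_rows (yz : {ffun 'I_n -> Y} * Z) : F :=
  T (row_word yz.1, yz.2, matrix_word yz.1).

Lemma derivation_row (i j : 'I_q.+1) y z : (i < j)%N ->
  derivation (raising_kernel (inl (i, j))) on_rows (y, z)
    = raise setT i j (fun x1 => T (x1, z, matrix_word y)) (row_word y).
Proof.
move=> lt_ij; rewrite /derivation /raise [RHS]big_mkcond; apply: eq_bigr => p _ /=.
rewrite in_setT /= lt_ij ffunE /= (bigD1 (j, (y p).2)) //= eqxx andbT big1 ?addr0; last first.
  by move=> u /negPf ->; rewrite andbF mul0r.
case: eqP => _; rewrite ?mul0r // mul1r /on_rows /=; congr (T (_, _, _)).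
  by apply/ffunP=> x; rewrite !ffunE; case: eqP.
by apply/ffunP=> x; rewrite !ffunE; case: eqP => // ->.
Qed.

Lemma derivation_matrix (i j : 'I_t.+1) y z : (i < j)%N ->
  derivation (raising_kernel (inr (i, j))) on_rows (y, z)
    = raise setT i j (fun x3 => T (row_word y, z, x3)) (matrix_word y).
Proof.
move=> lt_ij; rewrite /derivation /raise [RHS]big_mkcond sum_matrix.
apply: eq_bigr => p _ /=; under eq_bigr do rewrite mulr_suml.
rewrite exchange_big; apply: eq_bigr => m _ /=.
rewrite in_setT /= lt_ij ffunE mxvec_indexK /=.
rewrite (bigD1 ((y p).1, subst_letter (y p).2 m j)) //= eqxx andbT big1 ?addr0; last first.
  by move=> u /negPf ->; rewrite andbF mul0r.
case: eqP => _; rewrite ?mul0r // mul1r /on_rows /=; congr (T (_, _, _)).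
  by apply/ffunP=> x; rewrite !ffunE; case: eqP => // ->.
apply/ffunP=> x; case/mxvec_indexP: x => i' m'; rewrite !ffunE mxvec_indexK /=.
have -> : (mxvec_index i' m' == mxvec_index p m) = ((i', m') == (p, m)).
  by apply/eqP/eqP => [/(congr1 (@cell_of n l))|[-> ->]//]; rewrite !mxvec_indexK.
rewrite xpair_eqE; case: (eqVneq i' p) => [->|_] //=; by rewrite ffunE.
Qed.

End Translation.

Lemma row_word_act n (y : {ffun 'I_n -> Y}) (g1 : 'S_n) g2 :
  row_word (map_word (column_act g2) (permute y (g1^-1)%g)) = word_act (row_word y) g1.
Proof. by apply/ffunP=> i; rewrite !ffunE. Qed.

Lemma matrix_word_act n (y : {ffun 'I_n -> Y}) (g : 'S_n * 'S_l) :
  matrix_word (map_word (column_act g.2) (permute y (g.1^-1)%g))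
    = word_act (matrix_word y) (embed g).
Proof.
apply/ffunP=> p; case/mxvec_indexP: p => i m.
by rewrite !ffunE embed_invE !mxvec_indexK.
Qed.

Lemma column_act1 n (y : {ffun 'I_n -> Y}) : map_word (column_act 1%g) y = y.
Proof.
apply/ffunP=> i; rewrite !ffunE [RHS]surjective_pairing; congr (_, _).
by apply/ffunP=> m; rewrite ffunE invg1 perm1.
Qed.

Lemma permute1 n (y : {ffun 'I_n -> Y}) : permute y 1%g = y.
Proof. by apply/ffunP=> i; rewrite ffunE perm1. Qed.

Definition row_weight (la nu : seq nat) n (y : {ffun 'I_n -> Y}) :=
  has_content la (row_word y) /\ has_content nu (matrix_word y).

(** In terms of words of rows, the multiplicity space consists of elements of a
    symmetric power killed by derivations. *)
Lemma multiplicity_space_rows n s la mu nu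
    (T : {ffun 'I_n -> 'I_q.+1} * {ffun 'I_l -> 'I_s} * {ffun 'I_(n * l) -> 'I_t.+1} -> F) :
  multiplicity_space la mu nu T <->
  stable_space raising_kernel column_act (fun a (z : {ffun 'I_l -> 'I_s}) => word_act z a)
    (highest mu) (@row_weight la nu n) (on_rows T).
Proof.
split=> [[invT hla hmu hnu] | [symT colT derT wtT hmu]].
  have invY (g : 'S_n * 'S_l) y z : on_rows T
      (map_word (column_act g.2) (permute y (g.1^-1)%g), word_act z g.2) = on_rows T (y, z).
    by rewrite /on_rows /= row_word_act matrix_word_act invT.
  split.
  - move=> g y z; have := invY ((g^-1)%g, 1%g) y z.
    by rewrite /= column_act1 invgK word_act1.
  - by move=> a y z; have := invY (1%g, a) y z; rewrite /= invg1 permute1.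
  - case=> -[i j] [y z]; have [lt_ij|/negPf ge_ij] := boolP (i < j)%N.
    + by rewrite derivation_row //; apply: (hla _ _).2.
    + by rewrite /derivation big1 // => p _; rewrite big1 // => u _ /=; rewrite ge_ij mul0r.
    + by rewrite derivation_matrix //; apply: (hnu _ _).2.
    rewrite /derivation big1 // => p _; rewrite big1 // => u _ /=.
    by rewrite big1 ?mul0r // => m _; rewrite ge_ij.
  - move=> y z nz; split; first exact: (hla z (matrix_word y)).1.
    exact: (hnu (row_word y) z).1.
  by move=> y; exact: (hmu (row_word y) (matrix_word y)).
have TE x1 x2 x3 : T (x1, x2, x3) = on_rows T (join_words x1 x3, x2).
  by rewrite /on_rows /= row_wordK matrix_wordK.
split=> [g x1 x2 x3|x2 x3|x1 x3|x1 x2].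
- rewrite [RHS]TE -(symT (g.1^-1)%g) -(colT g.2) /on_rows /=.
  by rewrite row_word_act matrix_word_act row_wordK matrix_wordK.
- split=> [x1|i j lt_ij x1].
    by rewrite TE => /wtT[]; rewrite row_wordK.
  have := derT (inl (i, j)) (join_words x1 x3, x2).
  by rewrite derivation_row // row_wordK matrix_wordK.
- by have := hmu (join_words x1 x3); congr highest; apply/funext=> x2; rewrite TE.
split=> [x3|i j lt_ij x3].
  by rewrite TE => /wtT[]; rewrite matrix_wordK.
have := derT (inr (i, j)) (join_words x1 x3, x2).
by rewrite derivation_matrix // row_wordK matrix_wordK.
Qed.

Lemma multiplicity_dim_rows n s la mu nu d :
  has_dim (@multiplicity_space F n l la mu nu q.+1 s t.+1) d ->
  has_dim (stable_space raising_kernel column_act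
    (fun a (z : {ffun 'I_l -> 'I_s}) => word_act z a)
    (highest (F := F) mu) (@row_weight la nu n)) d.
Proof.
apply: (has_dim_iso (phi := @on_rows _ n)) => //.
- by move=> T /multiplicity_space_rows.
- move=> T _ T0 [[x1 x2] x3]; have := T0 (join_words x1 x3, x2).
  by rewrite /on_rows /= row_wordK matrix_wordK.
move=> v stab_v; pose T (x : _ * _ * _) : F := v (join_words x.1.1 x.2, x.1.2).
have vE : v =1 on_rows T by move=> [y z]; rewrite /on_rows /T /= join_wordsK.
by exists T => //; apply/multiplicity_space_rows; rewrite -(funext vE).
Qed.

Lemma count_row_delete n (y : {ffun 'I_n.+1 -> Y}) p i : y p = zero_letter ->
  count_letter setT (row_word y) i
    = ((i == ord0) + count_letter setT (row_word (delete p y)) i)%N.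
Proof.
move=> yp; rewrite /count_letter -!sum1dep_card.
rewrite big_mkcond (bigD1_ord p) //= in_setT ffunE yp /= eq_sym.
congr addn.
by rewrite [RHS]big_mkcond; apply: eq_bigr => m _; rewrite !in_setT !ffunE.
Qed.

Lemma count_matrix n (y : {ffun 'I_n -> Y}) i :
  count_letter setT (matrix_word y) i = (\sum_p \sum_m ((y p).2 m == i))%N.
Proof.
rewrite /count_letter -sum1dep_card big_mkcond sum_matrix; apply: eq_bigr => p _.
by apply: eq_bigr => m _; rewrite in_setT ffunE mxvec_indexK /=; case: eqP.
Qed.

Lemma count_matrix_delete n (y : {ffun 'I_n.+1 -> Y}) p i : y p = zero_letter ->
  count_letter setT (matrix_word y) i
    = ((i == ord0) * l + count_letter setT (matrix_word (delete p y)) i)%N.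
Proof.
move=> yp; rewrite !count_matrix (bigD1_ord p) //= yp; congr addn.
  under eq_bigr do rewrite ffunE eq_sym.
  by rewrite sum_nat_const card_ord mulnC.
by apply: eq_bigr => m _; rewrite ffunE.
Qed.

Lemma nth_add_first_row a la i : nth 0%N (add_first_row a la) i = (nth 0 la i + (i == 0) * a)%N.
Proof. by case: la i => [|x la] [|i] //=; rewrite ?mul1n ?mul0n ?addn0 ?nth_nil. Qed.

Lemma row_weight_delete n la nu a (y : {ffun 'I_n.+1 -> Y}) p : y p = zero_letter ->
  row_weight (add_first_row a.+1 la) (add_first_row (l * a.+1) nu) y <->
  row_weight (add_first_row a la) (add_first_row (l * a) nu) (delete p y).
Proof.
move=> yp; rewrite /row_weight; suff [E1 E2] :
    (has_content (add_first_row a.+1 la) (row_word y)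
      <-> has_content (add_first_row a la) (row_word (delete p y)))
    /\ (has_content (add_first_row (l * a.+1) nu) (matrix_word y)
      <-> has_content (add_first_row (l * a) nu) (matrix_word (delete p y))).
  by rewrite E1 E2.
have eq0 m (i : 'I_m.+1) : (i == ord0) = (nat_of_ord i == 0)%N by [].
split; split=> cy i; have := cy i; rewrite !nth_add_first_row.
- by rewrite (count_row_delete _ yp) eq0; case: eqP => _; lia.
- by rewrite (count_row_delete _ yp) eq0; case: eqP => _; lia.
- by rewrite (count_matrix_delete _ yp) eq0; case: eqP => _; lia.
by rewrite (count_matrix_delete _ yp) eq0; case: eqP => _; lia.
Qed.

(** All but [k] rows are labelled 0 and all but [k * l] entries are 0, so a word
    of more than [k + k * l] rows contains [x0]. *)
Lemma row_weight_zero_letter k a la nu (y : {ffun 'I_(k + a).+1 -> Y}) :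
    (k * l <= a)%N ->
    row_weight (add_first_row a.+1 la) (add_first_row (l * a.+1) nu) y ->
  exists p, y p = zero_letter.
Proof.
move=> le_a [/(_ ord0) cla /(_ ord0)]; rewrite count_matrix => cnu.
move: cla cnu; rewrite !nth_add_first_row /= !mul1n => cla cnu.
apply: contrapT => none.
have /negP[] : ~~ ((k + a).+1 <= k + k * l)%N by rewrite -ltnNge; lia.
have part1 : (#|[set p | (row_word y p != ord0)]| <= k)%N.
  have := cardsC [set p | row_word y p == ord0]; rewrite card_ord.
  have -> : ~: [set p | row_word y p == ord0] = [set p | row_word y p != ord0].
    by apply/setP=> p; rewrite !inE.
  have -> : #|[set p | row_word y p == ord0]| = count_letter setT (row_word y) ord0.
    by apply: eq_card => p; rewrite !inE.
  by rewrite cla; lia.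
have part2 : (\sum_p \sum_m ((y p).2 m != ord0) <= k * l)%N.
  have : (\sum_p \sum_m ((y p).2 m == ord0) + \sum_p \sum_m ((y p).2 m != ord0)
      = (k + a).+1 * l)%N.
    rewrite -big_split /= (eq_bigr (fun=> l)) ?sum_nat_const ?card_ord // => p _.
    rewrite -big_split /= (eq_bigr (fun=> 1%N)) ?sum_nat_const ?card_ord ?muln1 // => m _.
    by case: eqP.
  by rewrite cnu; nia.
apply: leq_trans (leq_add part1 part2).
rewrite -sum1dep_card big_mkcond -big_split /= -[X in (X <= _)%N]card_ord -sum1_card.
apply: leq_sum => p _; rewrite ffunE.
case: eqP => //= yp1; rewrite add0n.
have [m ym] : exists m, (y p).2 m != ord0.
  apply: contrapT => none2; case: none; exists p.
  rewrite [LHS]surjective_pairing yp1; congr (_, _); apply/ffunP=> m; rewrite ffunE.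
  by apply/eqP; apply: contraT => ne; case: none2; exists m.
by rewrite (bigD1 m) //= ym.
Qed.

End Rows.

Lemma add_first_row_partition n a la : (0 < n)%N -> is_partition n la ->
  is_partition (n + a) (add_first_row a la).
Proof.
case: la => [|x la] n_gt0 /and3P[]; first by move=> _ _ /eqP n0; rewrite -n0 in n_gt0.
rewrite inE negb_or /add_first_row /= => sorted_la /andP[nz_x nz_la] /eqP <-.
apply/and3P; split; last by rewrite /= addnAC.
  case: la sorted_la {nz_la} => //= x' la /andP[le_x ->]; rewrite andbT.
  by apply: leq_trans le_x _; apply: leq_addr.
by rewrite inE negb_or nz_la andbT; lia.
Qed.

Lemma size_add_first_row a la : (size (add_first_row a la) <= (size la).+1)%N.
Proof. by case: la. Qed.

(** The alphabets have one letter more than [la] and [nu] have parts, so that the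
    letter 0 exists by construction; the extra letter has weight 0. *)
Lemma b_coef_step (F : closedFieldType) (charF0 : [pchar F] =i pred0) k l la mu nu a :
    (0 < k)%N -> (0 < l)%N -> is_partition k la -> is_partition l mu ->
    is_partition (k * l) nu -> (k * l <= a)%N ->
  b_coef F (k + a).+1 l (add_first_row a.+1 la) mu (add_first_row (l * a.+1) nu)
    = b_coef F (k + a) l (add_first_row a la) mu (add_first_row (l * a) nu).
Proof.
move=> k_gt0 l_gt0 la_part mu_part nu_part le_a.
have dim_a b : has_dim (stable_space (@raising_kernel F l (size la) (size nu))
      (@column_act l (size la) (size nu))
      (fun a (z : {ffun 'I_l -> 'I_(size mu)}) => word_act z a) (highest (F := F) mu)
      (@row_weight l (size la) (size nu) (add_first_row b la) (add_first_row (l * b) nu) (k + b)))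
    (b_coef F (k + b) l (add_first_row b la) mu (add_first_row (l * b) nu)).
  apply: multiplicity_dim_rows; apply: b_coef_dim => //.
  - exact: add_first_row_partition.
  - by rewrite mulnDl [(b * l)%N]mulnC; apply: add_first_row_partition; rewrite ?muln_gt0 ?k_gt0.
  - exact: size_add_first_row.
  exact: size_add_first_row.
have := dim_a a.+1; rewrite addnS => dim_S; apply: has_dim_uniq dim_S _.
apply: stable_dim (dim_a a) => //.
- exact: raising_kernel_zero.
- exact: column_act_zero.
- split=> [w|i j _ w]; first by rewrite eqxx.
  by rewrite /raise big1.
- by move=> c u v; apply: highest_linear.
- by move=> y p; apply: row_weight_delete.
by move=> y; apply: row_weight_zero_letter.
Qed.

Local Close Scope ring_scope.

Theorem theorem24 (F : closedFieldType) (charF0 : [pchar F]%R =i pred0)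
    (k l : nat) (k_gt0 : 0 < k) (l_gt0 : 0 < l) (la mu nu : seq nat)
    (la_part : is_partition k la) (mu_part : is_partition l mu)
    (nu_part : is_partition (k * l) nu) :
  exists2 a0 : nat, 0 < a0 &
    forall a : nat, a0 <= a ->
      b_coef F (k + a) l (add_first_row a la) mu (add_first_row (l * a) nu)
      = b_coef F (k + a0) l (add_first_row a0 la) mu
          (add_first_row (l * a0) nu).
Proof.
exists (k * l); first by rewrite muln_gt0 k_gt0.
elim=> [|a IH] le_a; first by have := muln_gt0 k l; rewrite k_gt0 l_gt0; lia.
move: le_a; rewrite leq_eqVlt => /predU1P[->//|le_a].
by rewrite -IH // addnS b_coef_step.
Qed.
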